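(* Let $A,M,S$ be positive integers with $M\ge S^2$ and $M$ even, and let $L=M/2$. Let $\alpha,\beta>0$ and let $\Omega=\{\omega_j\}_{j=1}^S\subset\mathbb{T}$ satisfy the clumps model with a minimum separation with parameters $(A,L,S,\beta,\alpha)$, with clump cardinalities $\lambda_1,\dots,\lambda_A$, where $$\beta\ge\max_{1\le a\le A}\frac{20\,S^{1/2}\lambda_a^{5/2}}{\alpha^{1/2}}.$$ For $1\le a\le A$ let $c_a=C_a(\lambda_a,L)$. Let $x\in\mathbb{C}^S$ with $x_{\min}=\min_j|x_j|>0$, let $\sigma>0$, let $\eta\sim\mathcal{N}(0,\sigma^2I)$ be a Gaussian random vector of length $M+1$, and let $y=\Phi(\Omega,M)x+\eta$. Fix $\epsilon>0$ and $\nu>1$. If $$\frac{\sigma}{x_{\min}}<\frac{M}{4\sqrt{\nu(M+2)\log(M+2)}}\Big(\sum_{a=1}^A\big(c_a\,\alpha^{-\lambda_a+1}\big)^2\Big)^{-1}\epsilon,$$ then, with probability no less than $1-(M+2)^{-(\nu-1)}$, $$\sup_{\omega\in[0,1)}|\hat{\mathcal{R}}(\omega)-\mathcal{R}(\omega)|\le\epsilon.$$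
   Context: $\mathbb{T}=[0,1)$ is the periodic unit interval, $|\omega|_{\mathbb{T}}:=\min_{n\in\mathbb{Z}}|\omega-n|$. $\Phi(\Omega,M)$ is the $(M+1)\times S$ matrix with entries $e^{-2\pi i m\omega_j}$, $0\le m\le M$, $1\le j\le S$. $\mathcal{N}(0,\sigma^2I)$ means independent Gaussian entries of mean $0$ and variance $\sigma^2$. Clumps model with a minimum separation with parameters $(A,L,S,\beta,\alpha)$: (1) $\Omega$ has cardinality $S$ and is a disjoint union $\Omega=\bigcup_{a=1}^A\Lambda_a$ of nonempty finite sets, each $\Lambda_a$ contained in an open interval (arc) of length $1/L$; (2) if $A>1$, then $|\omega-\omega'|_{\mathbb{T}}\ge\beta/L$ whenever $\omega,\omega'$ belong to different $\Lambda_a$'s; (3) $\min_{j\ne k}|\omega_j-\omega_k|_{\mathbb{T}}\ge\alpha/L$ and $\max_a(\lambda_a-1)<1/\alpha$, where $\lambda_a=|\Lambda_a|$. Constants: for a positive integer $\lambda$ and an integer $L\ge\lambda$, $$B(\lambda,L):=\tfrac{20\sqrt2}{19}\Big(1-\tfrac{\pi^2}{3\lambda^2}\Big)^{-(\lambda-1)/2}\Big(\tfrac{L}{\lambda}\Big)^{\lambda-1}\Big\lfloor\tfrac{L}{\lambda}\Big\rfloor^{-(\lambda-1)},$$ $$C_a(\lambda,L):=B(\lambda,L)\,\lambda\Big(\tfrac{\lambda}{\pi}\Big)^{\lambda-1}\Big(\sum_{j=1}^{\lambda}\prod_{k=1,k\ne j}^{\lambda}\tfrac{1}{(j-k)^2}\Big)^{1/2}$$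 (powers with exponent $0$ and empty products equal $1$). MUSIC notation: for $z=(z_0,\dots,z_M)\in\mathbb{C}^{M+1}$, $\mathcal{H}(z)\in\mathbb{C}^{(L+1)\times(M-L+1)}$ is the Hankel matrix with entries $\mathcal{H}(z)_{p,q}=z_{p+q}$, $0\le p\le L$, $0\le q\le M-L$. With $y^0=\Phi(\Omega,M)x$, the matrix $\mathcal{H}(y^0)$ has rank $S$; $W$ is a matrix whose columns form an orthonormal basis of $\mathrm{Range}(\mathcal{H}(y^0))^\perp$ in $\mathbb{C}^{L+1}$. $\hat W$ is the matrix whose $L+1-S$ columns are the left singular vectors in a (full) singular value decomposition of $\mathcal{H}(y)$, with singular values in decreasing order, other than the first $S$ left singular vectors. With $\phi_L(\omega)=(1,e^{-2\pi i\omega},\dots,e^{-2\pi iL\omega})^T\in\mathbb{C}^{L+1}$, the noise-space correlation functions are $$\mathcal{R}(\omega)=\frac{\|W^*\phi_L(\omega)\|_2}{\|\phi_L(\omega)\|_2},\qquad \hat{\mathcal{R}}(\omega)=\frac{\|\hat W^*\phi_L(\omega)\|_2}{\|\phi_L(\omega)\|_2}.$$ *)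

(* Defs.v *)
From HB Require Import structures.
From mathcomp Require Import all_boot all_order all_algebra.
From mathcomp Require Import complex.
From mathcomp Require Import all_classical all_reals all_analysis.

Set Implicit Arguments.
Unset Strict Implicit.
Unset Printing Implicit Defensive.

Import Order.TTheory GRing.Theory Num.Theory.
Import numFieldNormedType.Exports.

Export ComplexField.Normc.

Local Open Scope classical_set_scope.
Local Open Scope sesquilinear_scope.
Local Open Scope ring_scope.

Section torus.
Variable R : realType.

Definition normT (x : R) : R := inf (range (fun n : int => `|x - n%:~R|)).

(* The class mod 1 of x lies in the open arc running from t to t + l. *)
Definition in_open_arc (t l x : R) : Prop :=
  exists n : int, t < x + n%:~R < t + l.

(* Omega is enumerated by omega : 'I_S -> R, and the clump Lambda_a is given by
   the set Lambda a of the indices of its elements. *)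
Record clumps_model (A L S : nat) (beta alpha : R)
    (omega : 'I_S -> R) (Lambda : 'I_A -> {set 'I_S}) : Prop := {
  cm_range : forall j, 0 <= omega j < 1 ;
  cm_card : injective omega ;
  cm_cover : forall j, exists a, j \in Lambda a ;
  cm_disjoint : forall a b j, j \in Lambda a -> j \in Lambda b -> a = b ;
  cm_nonempty : forall a, (0 < #|Lambda a|)%N ;
  cm_arc : forall a, exists t, forall j, j \in Lambda a ->
    in_open_arc t (L%:R^-1) (omega j) ;
  cm_clump_sep : (1 < A)%N -> forall a b, a != b ->
    forall j k, j \in Lambda a -> k \in Lambda b ->
      beta / L%:R <= normT (omega j - omega k) ;
  cm_point_sep : forall j k, j != k ->
    alpha / L%:R <= normT (omega j - omega k) ;
  cm_clump_card : forall a, (#|Lambda a|.-1)%:R < alpha^-1 }.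

End torus.

Section constants.
Variable R : realType.

Definition Bconst (lam L : nat) : R :=
  20 * Num.sqrt 2 / 19
  * (1 - pi ^+ 2 / (3 * lam%:R ^+ 2)) `^ (- ((lam%:R - 1) / 2))
  * (L%:R / lam%:R) ^+ lam.-1
  * ((L %/ lam)%N)%:R ^- lam.-1.

Definition Cconst (lam L : nat) : R :=
  Bconst lam L * lam%:R * (lam%:R / pi) ^+ lam.-1
  * Num.sqrt (\sum_(1 <= j < lam.+1)
                \prod_(1 <= k < lam.+1 | k != j) (1 / (j%:R - k%:R) ^+ 2)).

End constants.

Section music.
Variable R : realType.
Local Notation C := R[i].

Definition expi (t : R) : C := (cos t +i* sin t)%C.

Definition Fourier_mx (S M : nat) (omega : 'I_S -> R) : 'M[C]_(M.+1, S) :=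
  \matrix_(m, j) expi (- (2 * pi * m%:R * omega j)).

Definition steering (L : nat) (w : R) : 'cV[C]_L.+1 :=
  \col_p expi (- (2 * pi * p%:R * w)).

(* Meant for L <= M, in which case p + q <= M and inord (p + q) is p + q. *)
Definition Hankel (M L : nat) (z : 'cV[C]_M.+1) : 'M[C]_(L.+1, (M - L).+1) :=
  \matrix_(p, q) z (inord (p + q)) 0.

Definition norm2 (n : nat) (v : 'cV[C]_n) : R :=
  Num.sqrt (\sum_i normc (v i 0) ^+ 2).

Definition orthobasis_range_perp (m n k : nat)
    (H : 'M[C]_(m, n)) (W : 'M[C]_(m, k)) : Prop :=
  W ^t* *m W = 1%:M /\
  forall v : 'cV[C]_m,
    (exists c : 'cV[C]_k, v = W *m c) <->
    (forall u : 'cV[C]_n, (H *m u) ^t* *m v = 0).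

(* Only the values s i with i < minn m n enter the factorization. *)
Definition is_svd (m n : nat) (H : 'M[C]_(m, n))
    (U : 'M[C]_m) (s : nat -> R) (V : 'M[C]_n) : Prop :=
  [/\ U \is unitarymx, V \is unitarymx,
      forall i, 0 <= s i,
      forall i j, (i <= j)%N -> s j <= s i &
      H = U *m (\matrix_(i, j) (if i == j :> nat then (s i)%:C%C else 0))
            *m V ^t*].

Definition svd_noise_space (L n S : nat)
    (H : 'M[C]_(L.+1, n)) (W : 'M[C]_(L.+1, L.+1 - S)) : Prop :=
  exists U s V, is_svd H U s V /\
    forall p (k : 'I_(L.+1 - S)), W p k = U p (inord (S + k)).

Definition noise_corr (L k : nat) (W : 'M[C]_(L.+1, k)) (w : R) : R :=
  norm2 (W ^t* *m steering L w) / norm2 (steering L w).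

End music.

Section noise.
Context d (T : measurableType d) (R : realType) (P : probability T R).

Definition mutually_independent (I : finType) (X : I -> {RV P >-> R}) : Prop :=
  forall (J : {set I}) (B : I -> set R), (forall i, measurable (B i)) ->
    P (\bigcap_(i in [set i | i \in J]) (X i @^-1` B i))
    = (\prod_(i in J) P (X i @^-1` B i))%E.

(* The law N(0, sigma^2 I): real entries.  The second parameter of normal_prob
   is the standard deviation. *)
Definition gaussian_vector (n : nat) (sigma : R) (eta : 'I_n -> {RV P >-> R}) :
    Prop :=
  mutually_independent eta /\
  forall (i : 'I_n) (B : set R), measurable B ->
    distribution P (eta i) B = normal_prob 0 sigma B.

(* Inner formulation of P(A) >= q: A is not required to be measurable.  For
   measurable A it is equivalent to q <= P A. *)
Definition prob_at_least (q : R) (A : set T) : Prop :=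
  exists E : set T, [/\ measurable E, E `<=` A & (q%:E <= P E)%E].

End noise.

(* Main.v *)
(* Three estimates are combined.

   Deterministic perturbation. If |H0^* w| >= tau |w| on the range of H0 and
   |(H - H0)^* v| <= t0 |v|, then the noise spaces of H0 and H have projectors at
   distance at most 2 t0 / tau: the singular values are controlled by dimension
   counting, and each difference |What^* v| - |W^* v|, |W^* v| - |What^* v| by the
   component of one noise space in the other signal space.

   Smallest singular value of Phi = Phi(Omega, L), which enters through
   tau = xmin sigma_min(Phi)^2. It is bounded by duality with almost
   interpolating polynomials: f_j is the product of the Lagrange polynomial of
   the clump of omega_j dilated by Q = floor(L / lambda), of a long Dirichlet
   kernel, which carries the L^2 norm, and of the 2 lambda-th power of a short
   Dirichlet kernel, which makes f_j tiny at the other clumps. Using Dirichlet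
   kernels of unequal lengths improves on the constants of the statement by the
   factor 817/500.

   Noise. A real Hankel matrix is a corner of an anticirculant matrix, so its norm
   is at most the largest modulus of the discrete Fourier transform of the noise.
   Chernoff's bound for the 2L+1 real Fourier coefficients loses a factor 2 in the
   exponent against the matrix Gaussian series bound; the square of 817/500 makes
   up for it. *)
Require Import Defs.
From mathcomp Require Import all_boot all_order all_algebra.
From mathcomp Require Import complex.
From mathcomp Require Import all_classical all_reals all_analysis.
From mathcomp Require Import measurable_realfun.
From mathcomp Require Import ring lra zify.
Import Order.TTheory GRing.Theory Num.Theory.
Import numFieldNormedType.Exports.
Local Open Scope classical_set_scope.
Local Open Scope sesquilinear_scope.
Local Open Scope ring_scope.
Set Implicit Arguments.
Unset Strict Implicit.
Unset Printing Implicit Defensive.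

(** Raising the nodes of a clump to the power Q multiplies their gaps by Q, while the clump,
    contained in an arc of length 1/L, still fits in an arc of length 1/lambda, where sine is linear
    up to the factor 1 - pi^2 / (3 lambda^2). This costs degree Q (lambda - 1), so at least L /
    lambda is left for the kernels. The short kernel occurs to a power growing with lambda because
    its smallness must beat Lagrange denominators of order alpha^(lambda - 1).

    The factor 817/500 comes from the squared norm 5 lambda / (4 L) of the long kernel and the
    tolerated error 5/128 at the other nodes: against 20 sqrt 2 / 19 they give (1 - 5/128)^2 * 640 /
    361. It multiplies tau, hence the admissible noise norm, and so enters the Gaussian exponent
    squared. The square is at least 8/3, which leaves the exponent 4/3 nu (M+2) log(M+2) / (M+1);
    its surplus over nu log(M+2) pays for the factor 2 of the two-sided tail. *)

(** * Taylor bounds for sine and cosine, and Jordan's inequality *)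

Lemma ger0_derive_le0 (R : realType) (f df : R -> R) :
  (forall x : R, is_derive x 1 f (df x)) -> (forall x, 0 <= x -> 0 <= df x) ->
  forall x, 0 <= x -> f 0 <= f x.
Proof.
move=> fd df0 x; rewrite le_eqVlt => /predU1P[<-//|x0].
have [|c /andP[]] := @MVT R f df 0 x x0 (fun y _ => fd y).
  apply: continuous_subspaceT => y.
  by apply: differentiable_continuous; apply/derivable1_diffP; apply: (@ex_derive _ _ _ _ _ _ _ (fd y)).
rewrite !bnd_simp => c0 _ e.
by rewrite -subr_ge0 e subr0; exact: mulr_ge0 (df0 _ (ltW c0)) (ltW x0).
Qed.

(** [cos_le1] integrated once; each of the next three lemmas integrates its predecessor. *)
Lemma sin_le (R : realType) (x : R) : 0 <= x -> sin x <= x.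
Proof.
move=> x0.
have := @ger0_derive_le0 R (fun x => x - sin x) (fun x => 1 - cos x) _ _ x x0.
rewrite sin0 subrr subr_ge0; apply=> y _; by rewrite subr_ge0 cos_le1.
Qed.

Lemma cos_ge_quadratic (R : realType) (x : R) :
  0 <= x -> 1 - x ^+ 2 / 2 <= cos x.
Proof.
move=> x0.
have := @ger0_derive_le0 R (fun x => cos x + x ^+ 2 / 2)
  (fun x => x - sin x) _ _ x x0.
rewrite cos0 expr0n/= mul0r addr0 -lerBlDr; apply=> [y|y y0]; last first.
  by rewrite subr_ge0 sin_le.
apply: is_derive_eq.
rewrite /GRing.scale/=; by field.
Qed.

Lemma sin_ge_cubic (R : realType) (x : R) :
  0 <= x -> x - x ^+ 3 / 6 <= sin x.
Proof.
move=> x0.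
have := @ger0_derive_le0 R (fun x => sin x - (x - x ^+ 3 / 6))
  (fun x => cos x - (1 - x ^+ 2 / 2)) _ _ x x0.
rewrite sin0 expr0n/= mul0r !subr0 subr_ge0; apply=> [y|y y0]; last first.
  by rewrite subr_ge0 cos_ge_quadratic.
apply: is_derive_eq.
rewrite /GRing.scale/=; by field.
Qed.

Lemma cos_le_quartic (R : realType) (x : R) :
  0 <= x -> cos x <= 1 - x ^+ 2 / 2 + x ^+ 4 / 24.
Proof.
move=> x0.
have := @ger0_derive_le0 R (fun x => 1 - x ^+ 2 / 2 + x ^+ 4 / 24 - cos x)
  (fun x => sin x - (x - x ^+ 3 / 6)) _ _ x x0.
rewrite cos0 !expr0n/= !mul0r subr0 addr0 subrr subr_ge0.
apply=> [y|y y0]; last first.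
  by rewrite subr_ge0 sin_ge_cubic.
apply: is_derive_eq.
rewrite /GRing.scale/=; by field.
Qed.

Lemma pi_lt (R : realType) : pi < 34 / 10 :> R.
Proof.
(* Otherwise 17/10 is at most pi/2, where cosine is nonnegative, but the quartic upper bound is
   negative at 17/10. *)
rewrite ltNge; apply/negP => pi_ge.
have : 0 <= cos (17 / 10 : R).
  apply: cos_ge0_pihalf; apply/andP; split.
    by have := @pi_gt0 R; lra.
  lra.
have := @cos_le_quartic R (17 / 10); rewrite !exprS expr0.
lra.
Qed.

Lemma sin_MVT (R : realType) (a b : R) : a < b ->
  exists2 c, a < c < b & sin b - sin a = cos c * (b - a).
Proof.
move=> ab; have [|c] := @MVT R sin cos a b ab (fun x _ => is_derive_sin x).
  by apply: continuous_subspaceT; exact: continuous_sin.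
by rewrite in_itv/= => cab e; exists c.
Qed.

(* Jordan's inequality, by concavity of sine on [0, pi/2]. *)
Lemma jordan_sin (R : realType) (x : R) :
  `|x| <= 2^-1 -> 2 * `|x| <= `|sin (pi * x)|.
Proof.
wlog x0 : x / 0 <= x.
  move=> h xh; have [x0|x0] := leP 0 x; first exact: h.
  have := h (- x); rewrite !normrN mulrN sinN normrN oppr_ge0 => -> //.
  exact: ltW.
rewrite ger0_norm// => xh.
have pi0 := @pi_gt0 R.
apply: le_trans (ler_norm _).
move: x0; rewrite le_eqVlt => /predU1P[<-|x0]; first by rewrite !mulr0 sin0.
move: xh; rewrite le_eqVlt => /predU1P[->|xh].
  by rewrite mulfV ?pnatr_eq0// sin_pihalf.
set t := pi * x; have t0 : 0 < t by rewrite mulr_gt0.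
have tp : t < pi / 2 by rewrite ltr_pM2l.
have [c /andP[c0 ct]] := sin_MVT t0; rewrite sin0 !subr0 => e1.
have [d /andP[td dp]] := sin_MVT tp; rewrite sin_pihalf => e2.
have cd : cos d <= cos c.
  apply: ltW; rewrite ltr_cos ?in_itv/=; [lra| |].
  - by apply/andP; split; lra.
  - by apply/andP; split; lra.
have xE : x = t / pi by rewrite /t mulrAC mulfV ?mul1r// gt_eqF.
rewrite xE mulrA ler_pdivrMr//.
have : cos d * (pi / 2 - t) * t <= cos c * t * (pi / 2 - t).
  by rewrite mulrAC ler_pM2r ?subr_gt0// ler_pM2r.
rewrite -e1 -e2; nra.
Qed.

(* The source of the factor [1 - pi^2 / (3 lam^2)] in [Bconst]. *)
Lemma sin_sqr_ge (R : realType) (n : nat) (y : R) : (1 < n)%N ->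
  0 <= y <= pi / n%:R ->
  y ^+ 2 * (1 - pi ^+ 2 / (3 * n%:R ^+ 2)) <= sin y ^+ 2.
Proof.
move=> n1 /andP[y0 yn].
have pi0 := @pi_gt0 R; have pi3 := @pi_lt R.
have n2 : 2 <= n%:R :> R by rewrite (ler_nat _ 2).
have y2 : y ^+ 2 <= pi ^+ 2 / n%:R ^+ 2.
  by rewrite -expr_div_n lerXn2r// nnegrE// divr_ge0 ?pi_ge0.
(* Keeps the cubic lower bound for sine nonnegative, so that it may be squared. *)
have yp : y ^+ 2 <= 3.
  apply: (le_trans y2); rewrite ler_pdivrMr ?exprn_gt0//; last by lra.
  by nra.
have s0 := sin_ge_cubic y0.
have q0 : 0 <= y - y ^+ 3 / 6.
  have -> : y - y ^+ 3 / 6 = y * (1 - y ^+ 2 / 6) by rewrite exprSr; ring.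
  by rewrite mulr_ge0//; lra.
apply: (@le_trans _ _ ((y - y ^+ 3 / 6) ^+ 2)); last first.
  by rewrite lerXn2r// nnegrE// (le_trans q0).
have -> : (y - y ^+ 3 / 6) ^+ 2 = y ^+ 2 * (1 - y ^+ 2 / 6) ^+ 2 by ring.
rewrite ler_wpM2l ?sqr_ge0//.
have -> : (pi : R) ^+ 2 / (3 * n%:R ^+ 2) = ((pi : R) ^+ 2 / n%:R ^+ 2) / 3.
  by field; rewrite gt_eqF// (lt_le_trans _ n2).
nra.
Qed.

(** * Integrals against densities, and products of independent variables *)

Import HBNNSimple.

(** Change of variables when the measure of density [g] has image [nu] under [X], by approximation
    with simple functions. With [X] the identity it integrates against the normal density; with [X]
    one of the independent variables it splits off one factor of a product. *)
Lemma ge0_integral_density d d' (T : measurableType d) (T' : measurableType d')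
    (R : realType) (mu : {measure set T -> \bar R})
    (nu : {measure set T' -> \bar R}) (X : T -> T') (g : T -> R) :
  measurable_fun setT X -> measurable_fun setT g -> (forall x, 0 <= g x) ->
  (forall B, measurable B -> (\int[mu]_(x in X @^-1` B) (g x)%:E = nu B)%E) ->
  forall f : T' -> \bar R, measurable_fun setT f -> (forall y, (0 <= f y)%E) ->
  (\int[mu]_x (f (X x) * (g x)%:E) = \int[nu]_y f y)%E.
Proof.
move=> mX mg g0 dens f mf f0.
have mgE : measurable_fun setT (EFin \o g) by exact/measurable_EFinP.
pose h := nnsfun_approx measurableT mf.
have mh n : measurable_fun setT (EFin \o h n).
  by apply/measurable_EFinP; exact/measurable_funP.
have -> : (\int[nu]_y f y = lim (\int[nu]_y (EFin \o h n) y @[n --> \oo]))%E.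
  have fE y : f y = lim ((EFin \o h n) y @[n --> \oo]).
    by apply/esym/cvg_lim => //; exact: cvg_nnsfun_approx.
  under eq_integral => y _ do rewrite fE.
  apply: monotone_convergence => //.
  - by move=> n y _ //=; rewrite lee_fin.
  - by move=> y _ a b ab; rewrite lee_fin; exact/lefP/nd_nnsfun_approx.
have -> : (\int[mu]_x (f (X x) * (g x)%:E) =
    lim (\int[mu]_x ((h n (X x))%:E * (g x)%:E) @[n --> \oo]))%E.
  have fg x : (f (X x) * (g x)%:E =
      lim ((h n (X x))%:E * (g x)%:E @[n --> \oo]))%E.
    apply/esym/cvg_lim => //; apply: cvgeZr => //.
    exact: (@cvg_nnsfun_approx _ _ _ _ measurableT _ mf _ (X x)).
  under eq_integral => x _ do rewrite fg.
  apply: monotone_convergence => [//| | |].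
  - move=> n; apply/emeasurable_funM => //.
    exact: (measurableT_comp (mh n) mX).
  - by move=> n x _ /=; rewrite mule_ge0 ?lee_fin.
  - move=> x _ a b ab/=; rewrite lee_wpmul2r ?lee_fin//.
    exact/lefP/nd_nnsfun_approx.
suff suf n : (\int[mu]_x ((h n (X x))%:E * (g x)%:E) =
    \int[nu]_y (EFin \o h n) y)%E.
  by under eq_fun do rewrite suf.
transitivity (\int[nu]_y
   (\sum_(r \in range (h n)) (r * \1_(h n @^-1` [set r]) y)%:E))%E; last first.
  by apply: eq_integral => t tE; rewrite /= fimfunE -fsumEFin.
have indich r : measurable_fun setT (fun y => (r * \1_(h n @^-1` [set r]) y)%:E).
  by apply/measurable_EFinP; exact: measurable_funM.
rewrite ge0_integral_fsum//; last by move=> m y Ey; exact: nnfun_muleindic_ge0.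
transitivity (\int[mu]_x (\sum_(r \in range (h n))
    (r * \1_(h n @^-1` [set r]) (X x))%:E * (g x)%:E))%E.
  under [RHS]eq_integral => x xE.
    rewrite -ge0_mule_fsuml => [|y]; last exact: nnfun_muleindic_ge0.
    rewrite fsumEFin // -(fimfunE _ (X x)); over.
  by [].
rewrite ge0_integral_fsum//; last 2 first.
  - move=> y; apply: emeasurable_funM => //.
    exact: (measurableT_comp (indich y) mX).
  - move=> m y _; apply: mule_ge0; last by rewrite lee_fin.
    exact: nnfun_muleindic_ge0.
apply: eq_fsbigr => r rhn.
under [RHS]eq_integral do rewrite EFinM.
rewrite integralZl_indic_nnsfun => //.
under eq_integral do rewrite EFinM -muleA.
have mhr : measurable (h n @^-1` [set r]) by exact: measurable_funPTI.
have mXhr : measurable (X @^-1` (h n @^-1` [set r])).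
  by rewrite -[X in measurable X]setTI; exact: mX.
rewrite ge0_integralZl//.
- congr (_ * _)%E; rewrite integral_indic// setIT -dens// [RHS]integral_mkcond.
  apply: eq_integral => x _; rewrite patchE indicE.
  rewrite (_ : (X x \in _) = (x \in X @^-1` (h n @^-1` [set r]))); last first.
    by apply/idP/idP; rewrite !inE.
  by case: ifP; rewrite ?mul1e ?mul0e.
- apply: emeasurable_funM => //; apply/measurable_EFinP.
  have m1 : measurable_fun setT (\1_(h n @^-1` [set r]) : T' -> R) by exact: measurable_indic.
  exact: (measurableT_comp m1 mX).
- by move=> t Et; rewrite mule_ge0 ?lee_fin ?g0.
- by move: rhn; rewrite inE => -[t _ <-]; rewrite lee_fin.
Qed.

Lemma normal_mgf (R : realType) (b s : R) (Q : {measure set R -> \bar R}) :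
  0 < s -> (forall B : set R, measurable B -> Q B = normal_prob 0 s B) ->
  (\int[Q]_y (expR (b * y))%:E = (expR (b ^+ 2 * s ^+ 2 / 2))%:E)%E.
Proof.
move=> s0 QN; have sn0 : s != 0 by rewrite gt_eqF.
have me : measurable_fun setT (fun y : R => (expR (b * y))%:E).
  apply/measurable_EFinP; apply: (measurableT_comp (@measurable_expR _)).
  exact: mulrl_measurable.
have me0 (y : R) : (0 <= (expR (b * y))%:E)%E by rewrite lee_fin expR_ge0.
have mid : measurable_fun setT (@id (measurableTypeR R) : measurableTypeR R -> R) by [].
have dens (B : set R) : measurable B ->
    (\int[lebesgue_measure]_(x in @id R @^-1` B) (normal_pdf 0 s x)%:E = Q B)%E.
  by move=> mB; rewrite QN.
rewrite -(ge0_integral_density mid (measurable_normal_pdf 0 s)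
  (normal_pdf_ge0 0 s) dens me me0).
(* Completing the square: tilting the density by exp(b y) shifts its mean to b s^2, up to a
   constant. *)
transitivity (\int[lebesgue_measure]_y
   ((expR (b ^+ 2 * s ^+ 2 / 2))%:E * (normal_pdf (b * s ^+ 2) s y)%:E))%E.
  apply: eq_integral => y _; rewrite -!EFinM; congr EFin.
  rewrite !normal_pdfE// /normal_fun mulrCA [RHS]mulrCA -!expRD; congr (_ * expR _).
  by field.
rewrite ge0_integralZl//=.
- by rewrite integral_normal_pdf mule1.
- by apply/measurable_EFinP; exact: measurable_normal_pdf.
- by move=> y _; rewrite lee_fin normal_pdf_ge0.
Qed.

Section independence.
Context d (T : measurableType d) (R : realType) (P : probability T R).
Variables (I : finType) (X : I -> {RV P >-> R}).
Hypothesis indep : mutually_independent X.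
Variables (f : I -> R -> R) (m : I -> R).
Hypothesis mf : forall i, measurable_fun setT (f i).
Hypothesis f0 : forall i y, 0 <= f i y.
Hypothesis fm : forall i, (\int[P]_t (f i (X i t))%:E = (m i)%:E)%E.

Let m_ge0 i : 0 <= m i.
Proof. by rewrite -lee_fin -fm integral_ge0// => t _; rewrite lee_fin. Qed.

Let mfX i : measurable_fun setT (fun t => f i (X i t)).
Proof. exact: (measurableT_comp (mf i)). Qed.

Let mprod (K : seq I) : measurable_fun setT (fun t => \prod_(i <- K) f i (X i t)).
Proof.
elim: K => [|j K IH].
  by under eq_fun do rewrite big_nil; exact: measurable_cst.
by under eq_fun do rewrite big_cons; exact: measurable_funM.
Qed.

Let mcap (K : seq I) (B : I -> set R) : (forall i, measurable (B i)) ->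
  measurable (\bigcap_(i in [set i | i \notin K]) (X i @^-1` B i)).
Proof.
move=> mB; apply: fin_bigcap_measurable => [|i _]; first exact: finite_finset.
exact: measurable_funPTI.
Qed.

Let probE (B : I -> set R) i : (forall i, measurable (B i)) ->
  P (X i @^-1` B i) = (fine (P (X i @^-1` B i)))%:E.
Proof. by move=> mB; rewrite fineK// fin_num_measure//; exact: measurable_funPTI. Qed.

(** Independence is given for events only, so the factors are integrated one at a time while the
    remaining variables are confined to sets [B i]. The induction hypothesis with [B j] replaced by
    an arbitrary [A] says that the law of [X j], weighted by the other factors, is a multiple of its
    own law, which is what [ge0_integral_density] asks for. For empty [K] the claim is independence
    itself. *)
Lemma independent_partial_prod (K : seq I) (B : I -> set R) : uniq K ->
  (forall i, measurable (B i)) ->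
  (\int[P]_(t in \bigcap_(i in [set i | i \notin K]) (X i @^-1` B i))
      (\prod_(i <- K) f i (X i t))%:E =
   ((\prod_(i <- K) m i) *
     \prod_(i | i \notin K) fine (P (X i @^-1` B i)))%:E)%E.
Proof.
elim: K B => [|j K IH] B => [_ mB|]; last rewrite cons_uniq => /andP[jK uK] mB.
  under eq_integral do rewrite big_nil.
  rewrite integral_cst ?mul1e; last exact: mcap.
  have := indep [set: I]%SET mB.
  rewrite (_ : [set i | i \in [set: I]%SET] = [set i | i \notin [::]]); last first.
    by apply/seteqP; split => i /=; rewrite ?inE.
  move=> e; refine (eq_trans e _); rewrite big_nil mul1r.
  rewrite -prodEFin; apply: eq_big => i; first by rewrite !inE.
  by move=> _; rewrite -probE.
pose D := \bigcap_(i in [set i | i \notin j :: K]) (X i @^-1` B i).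
have mD : measurable D by exact: mcap.
pose g t := \prod_(i <- K) f i (X i t) * \1_D t.
have mg : measurable_fun setT g.
  by apply: measurable_funM; [exact: mprod|exact: measurable_indic].
have g0 t : 0 <= g t by rewrite mulr_ge0 ?prodr_ge0.
pose c := \prod_(i <- K) m i *
  \prod_(i | i \notin j :: K) fine (P (X i @^-1` B i)).
have c0 : 0 <= c.
  by rewrite mulr_ge0 ?prodr_ge0// => i _; rewrite fine_ge0.
have dens A : measurable A ->
    (\int[P]_(t in X j @^-1` A) (g t)%:E =
     mscale (NngNum c0) (distribution P (X j)) A)%E.
  move=> mA; pose B' i := if i == j then A else B i.
  have mB' i : measurable (B' i) by rewrite /B'; case: eqP.
  have := IH B' uK mB'.
  have -> : \bigcap_(i in [set i | i \notin K]) (X i @^-1` B' i) =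
      X j @^-1` A `&` D.
    apply/seteqP; split => [t h|t [tA tD] i /= iK].
      split; first by have := h j jK; rewrite /= /B' eqxx.
      move=> i; rewrite /= in_cons negb_or => /andP[ij iK].
      by have := h i iK; rewrite /= /B' (negbTE ij).
    rewrite /B'; have [->//|ij] := eqVneq i j.
    by apply: tD; rewrite /= in_cons negb_or ij.
  rewrite integral_mkcondr => e; transitivity
    (\int[P]_(x in X j @^-1` A)
      ((fun t => (\prod_(i <- K) f i (X i t))%:E) \_ D) x)%E.
    apply: eq_integral => t _; rewrite patchE /g indicE.
    by case: ifP; rewrite ?mulr1 ?mulr0.
  rewrite e /mscale/= (_ : distribution _ _ _ = (fine (P (X j @^-1` A)))%:E);
    last exact: (@probE (fun=> A)).
  rewrite /c -EFinM; congr EFin.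
  rewrite [\prod_(i | i \notin K) _](bigD1 j)//= {1}/B' eqxx.
  rewrite mulrCA mulrC; congr (_ * _ * _).
  apply: eq_big => i; first by rewrite in_cons negb_or andbC.
  by rewrite /B' => /andP[_ /negbTE ->].
have mfj : measurable_fun setT (EFin \o f j) by exact/measurable_EFinP.
have fj0 y : (0 <= (EFin \o f j) y)%E by rewrite lee_fin.
have mXj : measurable_fun setT (X j) by [].
have := ge0_integral_density mXj mg g0 dens mfj fj0.
rewrite ge0_integral_mscale// ge0_integral_distribution// fm => e.
rewrite integral_mkcond; refine (eq_trans _ (eq_trans e _)).
  apply: eq_integral => t _; rewrite patchE /= /g indicE big_cons -/D -EFinM.
  by case: ifP; rewrite ?mulr1 ?mulr0.
by rewrite /= -EFinM /c big_cons; congr EFin; ring.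
Qed.

Lemma independent_prod : (\int[P]_t (\prod_i f i (X i t))%:E = (\prod_i m i)%:E)%E.
Proof.
have := @independent_partial_prod (enum I) (fun=> setT) (enum_uniq _) (fun=> measurableT).
rewrite (_ : \bigcap_(_ in _) _ = setT); last first.
  by apply/seteqP; split => // t _ i _; rewrite preimage_setT.
rewrite [\prod_(i | _) _]big1 ?mulr1; last first.
  by move=> i _; rewrite preimage_setT probability_setT.
by rewrite big_enum/=; under eq_integral do rewrite big_enum.
Qed.

End independence.

(** * Chernoff bounds for linear forms in a Gaussian vector *)

Section gaussian_tail.
Context d (T : measurableType d) (R : realType) (P : probability T R).
Variables (n : nat) (sigma : R) (eta : 'I_n -> {RV P >-> R}).
Hypotheses (s0 : 0 < sigma) (heta : gaussian_vector sigma eta).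

Lemma measurable_lincomb (a : 'I_n -> R) :
  measurable_fun setT (fun t => \sum_i a i * eta i t).
Proof.
apply: measurable_sum => i; exact: measurable_funM.
Qed.

Lemma gaussian_mgf (a : 'I_n -> R) :
  (\int[P]_t (expR (\sum_i a i * eta i t))%:E =
   (expR (sigma ^+ 2 * (\sum_i a i ^+ 2) / 2))%:E)%E.
Proof.
have me b : measurable_fun setT (fun y : R => expR (b * y)).
  by apply: (measurableT_comp (@measurable_expR _)); exact: mulrl_measurable.
have em i : (\int[P]_t (expR (a i * eta i t))%:E =
    (expR (a i ^+ 2 * sigma ^+ 2 / 2))%:E)%E.
  rewrite -(@normal_mgf _ _ _ (distribution P (eta i)) s0 (heta.2 i)).
  by rewrite ge0_integral_distribution//; exact/measurable_EFinP.
under eq_integral do rewrite expR_sum.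
rewrite (independent_prod heta.1 (fun i => me (a i)) (fun i y => expR_ge0 _) em).
rewrite -expR_sum; congr (expR _)%:E.
by rewrite mulr_sumr mulr_suml; apply: eq_bigr => i _; ring.
Qed.

Lemma gaussian_tail (a : 'I_n -> R) (V s : R) : \sum_i a i ^+ 2 <= V ->
  0 < V -> 0 < s ->
  (P [set t | (s <= \sum_i a i * eta i t)%R] <=
   (expR (- (s ^+ 2 / (2 * sigma ^+ 2 * V))))%:E)%E.
Proof.
move=> aV V0 sp; set A := [set t | _].
have mA : measurable A.
  rewrite -[A]setTI; apply: measurable_fun_le => //.
  exact: measurable_lincomb.
(* Minimizes the Chernoff exponent - r s + sigma^2 r^2 V / 2. *)
pose r := s / (sigma ^+ 2 * V).
have r0 : 0 < r by rewrite divr_gt0// mulr_gt0// exprn_gt0.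
have me : measurable_fun setT (fun t => (expR (\sum_i (r * a i) * eta i t))%:E).
  apply/measurable_EFinP; apply: (measurableT_comp (@measurable_expR _)).
  exact: measurable_lincomb.
apply: (@le_trans _ _ (\int[P]_t ((expR (- (r * s)))%:E *
    (expR (\sum_i (r * a i) * eta i t))%:E))%E); last first.
  rewrite ge0_integralZl// gaussian_mgf -EFinM lee_fin -expRD ler_expR.
  have : \sum_i (r * a i) ^+ 2 <= r ^+ 2 * V.
    by under eq_bigr do rewrite exprMn; rewrite -mulr_sumr ler_wpM2l ?sqr_ge0.
  move=> /(ler_wpM2l (sqr_ge0 sigma)) h.
  have -> : - (s ^+ 2 / (2 * sigma ^+ 2 * V)) =
     - (r * s) + sigma ^+ 2 * (r ^+ 2 * V) / 2.
    by rewrite /r; field; rewrite !gt_eqF.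
  by rewrite lerD2l ler_pM2r.
rewrite -[A in P A]setIT -integral_indic//.
apply: ge0_le_integral => //.
- by apply/measurable_EFinP; exact: measurable_indic.
- exact: (emeasurable_funM (measurable_cst _) me).
- move=> t _; rewrite indicE; case: (boolP (t \in A)) => [|_]; last first.
    by rewrite -EFinM lee_fin mulr_ge0 ?expR_ge0.
  rewrite inE /A/= -EFinM lee_fin -expRD => h.
  rewrite -[leLHS]expR0 ler_expR addrC subr_ge0.
  under eq_bigr do rewrite -mulrA.
  by rewrite -mulr_sumr ler_wpM2l// ltW.
Qed.

Lemma gaussian_tail_norm (a : 'I_n -> R) (V s : R) : \sum_i a i ^+ 2 <= V ->
  0 < V -> 0 < s ->
  measurable [set t | s <= `|\sum_i a i * eta i t|] /\
  (P [set t | (s <= `|\sum_i a i * eta i t|)%R] <=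
   (2 * expR (- (s ^+ 2 / (2 * sigma ^+ 2 * V))))%:E)%E.
Proof.
move=> aV V0 sp.
have mle b : measurable [set t | s <= \sum_i b i * eta i t].
  rewrite -[X in measurable X]setTI; apply: measurable_fun_le => //.
  exact: measurable_lincomb.
have -> : [set t | s <= `|\sum_i a i * eta i t|] =
   [set t | s <= \sum_i a i * eta i t] `|` [set t | s <= \sum_i - a i * eta i t].
  have e t : \sum_i - a i * eta i t = - \sum_i a i * eta i t.
    by under eq_bigr do rewrite mulNr; rewrite sumrN.
  by apply/seteqP; split => t /=; rewrite e ler_normr => /orP.
split; first exact: measurableU.
apply: (le_trans (measureU2 _ _ _)) => //.
rewrite mulr_natl mulr2n EFinD leeD//; apply: gaussian_tail => //.
by under eq_bigr do rewrite sqrrN.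
Qed.
End gaussian_tail.

(** * Hermitian linear algebra over column vectors *)

Section euclidean.
Variable R : realType.
Local Notation C := R[i].

Lemma normc_ge0 (z : C) : 0 <= normc z.
Proof. by case: z => a b; exact: sqrtr_ge0. Qed.

Lemma normr_normc (z : C) : `|z| = (normc z)%:C%C.
Proof. by rewrite normc_def; case: z. Qed.

Lemma conjC_normc (z : C) : z^* * z = ((normc z ^+ 2)%:C)%C.
Proof. by rewrite mulrC -normCK normr_normc -rmorphXn. Qed.

Lemma normc_conj (z : C) : normc (z^*) = normc z.
Proof.
by apply: complexI; rewrite -!normr_normc norm_conjC.
Qed.

Lemma conjC_realC (x : R) : (x%:C%C : C)^* = x%:C%C.
Proof. by rewrite conj_Creal// realE !lecR -realE num_real. Qed.

Lemma conjC_mulC (x y : C) : (x * y)^* = x^* * y^*.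
Proof. exact: rmorphM. Qed.

Lemma normc_real (x : R) : normc (x%:C%C) = `|x|.
Proof. by rewrite /normc/= expr0n addr0 sqrtr_sqr. Qed.

Lemma normc_sum (I : Type) (r : seq I) (P : pred I) (F : I -> C) :
  normc (\sum_(i <- r | P i) F i) <= \sum_(i <- r | P i) normc (F i).
Proof.
elim/big_ind2 : _ => //; first by rewrite normc0.
by move=> x a y b ha hb; apply: le_trans (le_normcD _ _) _; rewrite lerD.
Qed.

Lemma normc_prod (I : Type) (r : seq I) (P : pred I) (F : I -> C) :
  normc (\prod_(i <- r | P i) F i) = \prod_(i <- r | P i) normc (F i).
Proof. by elim/big_ind2 : _ => [|x a y b <- <-|//]; rewrite ?normc1 ?normcM. Qed.

Lemma normcX (z : C) n : normc (z ^+ n) = normc z ^+ n.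
Proof. by elim: n => [|n IH]; rewrite ?normc1// !exprS normcM IH. Qed.

(** Lagrange's identity: the right side minus the left is half of a double sum of squares. *)
Lemma cauchy_schwarz_sum (I : finType) (P : pred I) (a b : I -> R) :
  (\sum_(i | P i) a i * b i) ^+ 2 <=
  (\sum_(i | P i) a i ^+ 2) * (\sum_(i | P i) b i ^+ 2).
Proof.
have h : 0 <= \sum_(i | P i) \sum_(j | P j) (a i * b j - a j * b i) ^+ 2.
  by apply: sumr_ge0 => i _; apply: sumr_ge0 => j _; exact: sqr_ge0.
have e : \sum_(i | P i) \sum_(j | P j) (a i * b j - a j * b i) ^+ 2 =
  2 * ((\sum_(i | P i) a i ^+ 2) * (\sum_(i | P i) b i ^+ 2)
     - (\sum_(i | P i) a i * b i) ^+ 2).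
  transitivity (\sum_(i | P i) \sum_(j | P j) (a i ^+ 2 * b j ^+ 2)
      + \sum_(i | P i) \sum_(j | P j) (b i ^+ 2 * a j ^+ 2)
      - 2 * \sum_(i | P i) \sum_(j | P j) ((a i * b i) * (a j * b j))).
    rewrite mulr_sumr -!(big_split, sumrB)/=.
    apply: eq_bigr => i _; rewrite mulr_sumr -!(big_split, sumrB)/=.
    by apply: eq_bigr => j _; ring.
  have s f g : \sum_(i | P i) \sum_(j | P j) (f i * g j) =
     (\sum_(i | P i) f i) * (\sum_(i | P i) g i) :> R.
    by rewrite mulr_suml; apply: eq_bigr => i _; rewrite mulr_sumr.
  by rewrite !s; ring.
by rewrite -subr_ge0 -(pmulr_rge0 _ (@ltr0n R 2)) -e.
Qed.

Lemma norm2_ge0 n (v : 'cV[C]_n) : 0 <= norm2 v.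
Proof. exact: sqrtr_ge0. Qed.

Lemma norm2_sqr n (v : 'cV[C]_n) : norm2 v ^+ 2 = \sum_i normc (v i 0) ^+ 2.
Proof. by rewrite sqr_sqrtr// sumr_ge0// => i _; exact: sqr_ge0. Qed.

Lemma norm2_mxE n (v : 'cV[C]_n) : v ^t* *m v = ((norm2 v ^+ 2)%:C%C)%:M.
Proof.
apply/matrixP => i j; rewrite !ord1 !mxE mulr1n norm2_sqr rmorph_sum.
by apply: eq_bigr => k _; rewrite !mxE conjC_normc.
Qed.

Lemma eq_norm2 n m (v : 'cV[C]_n) (w : 'cV[C]_m) :
  v ^t* *m v = w ^t* *m w -> norm2 v = norm2 w.
Proof.
rewrite !norm2_mxE => /matrixP/(_ 0 0); rewrite !mxE !mulr1n => /complexI.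
by move=> /eqP; rewrite eqrXn2 ?norm2_ge0// => /eqP.
Qed.

Lemma norm2_eq0 n (v : 'cV[C]_n) : norm2 v = 0 -> v = 0.
Proof.
move=> v0; have := norm2_sqr v; rewrite v0 expr0n/= => /esym/eqP.
rewrite psumr_eq0 => [/allP h|i _]; last exact: sqr_ge0.
apply/matrixP => i j; rewrite ord1 mxE; have := h i (mem_index_enum _).
by rewrite sqrf_eq0 => /eqP/eq0_normc.
Qed.

Lemma norm20 n : norm2 (0 : 'cV[C]_n) = 0.
Proof.
by rewrite /norm2 big1 ?sqrtr0// => i _; rewrite mxE normc0 expr0n.
Qed.

Lemma norm2_gt0 n (v : 'cV[C]_n) : v != 0 -> 0 < norm2 v.
Proof.
by move=> v0; rewrite lt_def norm2_ge0 andbT; apply: contra_neq v0 => /norm2_eq0.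
Qed.

Lemma norm2_dot n (v w : 'cV[C]_n) : normc ((v ^t* *m w) 0 0) <= norm2 v * norm2 w.
Proof.
rewrite -(@ler_pXn2r _ 2)// ?nnegrE ?normc_ge0 ?mulr_ge0 ?norm2_ge0//.
rewrite exprMn !norm2_sqr; apply: le_trans (cauchy_schwarz_sum _ _ _).
rewrite lerXn2r ?nnegrE ?normc_ge0 ?sumr_ge0//.
  by move=> i _; rewrite mulr_ge0 ?normc_ge0.
rewrite mxE; apply: le_trans (normc_sum _ _ _) _; apply: ler_sum => i _.
by rewrite normcM !mxE normc_conj.
Qed.

Lemma norm2D n (v w : 'cV[C]_n) : norm2 (v + w) <= norm2 v + norm2 w.
Proof.
rewrite -(@ler_pXn2r _ 2)// ?nnegrE ?addr_ge0 ?norm2_ge0//.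
rewrite sqrrD norm2_sqr.
apply: (@le_trans _ _ (\sum_i (normc (v i 0) ^+ 2 +
    2 * (normc (v i 0) * normc (w i 0)) + normc (w i 0) ^+ 2))).
  apply: ler_sum => i _; rewrite mxE mulr_natl -sqrrD lerXn2r ?nnegrE ?addr_ge0 ?normc_ge0//.
  exact: le_normcD.
rewrite !big_split/= -!norm2_sqr lerD2r lerD2l -mulr_sumr mulr_natl ler_pMn2r//.
apply: le_trans (ler_norm _) _.
rewrite -(@ler_pXn2r _ 2)// ?nnegrE ?mulr_ge0 ?norm2_ge0//.
rewrite exprMn !norm2_sqr real_normK ?num_real//.
exact: cauchy_schwarz_sum.
Qed.

Lemma norm2N n (v : 'cV[C]_n) : norm2 (- v) = norm2 v.
Proof.
rewrite /norm2; congr Num.sqrt; apply: eq_bigr => i _.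
by rewrite mxE normcN.
Qed.

Lemma norm2B n (v w : 'cV[C]_n) : norm2 (v - w) <= norm2 v + norm2 w.
Proof. by rewrite -(norm2N w); exact: norm2D. Qed.

Lemma norm2_isometry n m (W : 'M[C]_(m, n)) (v : 'cV[C]_n) :
  W ^t* *m W = 1%:M -> norm2 (W *m v) = norm2 v.
Proof.
move=> W1; apply: eq_norm2; rewrite trmx_mul map_mxM -mulmxA.
by rewrite (mulmxA (W ^t*)) W1 mul1mx.
Qed.

Lemma ctrmxM m n p (A : 'M[C]_(m, n)) (B : 'M[C]_(n, p)) :
  (A *m B) ^t* = B ^t* *m A ^t*.
Proof. by rewrite trmx_mul map_mxM. Qed.

Lemma ctrmxD m n (A B : 'M[C]_(m, n)) : (A + B) ^t* = A ^t* + B ^t*.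
Proof. by apply/matrixP => i j; rewrite !mxE rmorphD. Qed.

Lemma ctrmxK m n (A : 'M[C]_(m, n)) : (A ^t*) ^t* = A.
Proof. by apply/matrixP => i j; rewrite !mxE conjCK. Qed.

Lemma inj_unitmx n (A : 'M[C]_n) :
  (forall v : 'cV[C]_n, A *m v = 0 -> v = 0) -> A \in unitmx.
Proof.
move=> inj; rewrite -unitmx_tr -row_free_unit -kermx_eq0.
apply/eqP/row_matrixP => i; rewrite row0.
have : A *m (row i (kermx A^T))^T = 0.
  rewrite -[A in A *m _]trmxK -trmx_mul -row_mul mulmx_ker row0.
  exact: trmx0.
by move=> /inj /(congr1 trmx); rewrite trmxK trmx0.
Qed.

Lemma wide_kernel m n (A : 'M[C]_(m, n)) : (m < n)%N ->
  exists2 v : 'cV[C]_n, v != 0 & A *m v = 0.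
Proof.
move=> mn; have : kermx A^T != 0.
  rewrite kermx_eq0 /row_free mxrank_tr neq_ltn (leq_ltn_trans (rank_leq_row A))//.
move=> /rowV0Pn[v vk v0]; exists v^T.
  by apply: contra v0 => /eqP/(congr1 trmx); rewrite trmxK trmx0 => ->.
by rewrite -[A]trmxK -trmx_mul (sub_kermxP vk) trmx0.
Qed.

End euclidean.

(** * Singular values and the adjoint of a matrix *)

Section svd.
Variable R : realType.
Local Notation C := R[i].
Variables (m n : nat) (H : 'M[C]_(m, n)) (U : 'M[C]_m) (s : nat -> R)
  (V : 'M[C]_n).
Hypothesis hsvd : is_svd H U s V.

(* Padding by 0 makes the singular values indexed by the rows of U even if [n < m]. *)
Let s' (i : nat) : R := if (i < n)%N then s i else 0.

Let s'_ge0 i : 0 <= s' i.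
Proof. by case: hsvd => _ _ s0 _ _; rewrite /s'; case: ifP. Qed.

Let s'_decr i j : (i <= j)%N -> s' j <= s' i.
Proof.
case: hsvd => _ _ s0 sd _ ij; rewrite /s'; case: ifPn => jn; last by case: ifP.
by rewrite (leq_ltn_trans ij jn) sd.
Qed.

Let UU : U ^t* *m U = 1%:M.
Proof. by case: hsvd => /unitarymxP/mulmx1C. Qed.

Lemma svd_coord (v : 'cV[C]_m) : norm2 v = norm2 (U ^t* *m v).
Proof.
case: hsvd => /unitarymxP UU' _ _ _ _.
by rewrite [RHS]norm2_isometry// ctrmxK.
Qed.

Lemma svd_coordK (v : 'cV[C]_m) : U ^t* *m (U *m v) = v.
Proof. by rewrite mulmxA UU mul1mx. Qed.

Lemma svd_norm2_adj (v : 'cV[C]_m) : norm2 (H ^t* *m v) ^+ 2 =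
  \sum_(i < m) s' i ^+ 2 * normc ((U ^t* *m v) i 0) ^+ 2.
Proof.
case: hsvd => _ /unitarymxP/mulmx1C VV _ _ ->.
set Sg := \matrix_(i, j) _; rewrite !ctrmxM ctrmxK -!mulmxA norm2_isometry//.
set a := U ^t* *m v.
suff h : norm2 (Sg ^t* *m a) = norm2 (\col_i ((s' i)%:C%C * a i 0)).
  rewrite h norm2_sqr; apply: eq_bigr => i _; rewrite mxE normcM normc_real.
  by rewrite ger0_norm// exprMn.
apply: eq_norm2; rewrite ctrmxM ctrmxK -mulmxA (mulmxA Sg).
(* The adjoint only sees this Gram matrix of the rectangular [Sg]; rows of index at least [n]
   contribute 0, as recorded by [s']. *)
have -> : Sg *m Sg ^t* = diag_mx (\row_i ((s' i)%:C%C ^+ 2)).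
  apply/matrixP => i k; rewrite !mxE.
  under eq_bigr do rewrite !mxE.
  have [ik|ik] := eqVneq i k; last first.
    rewrite mulr0n big1// => j _; have [ij|ij] := eqVneq (i : nat) j; last by rewrite mul0r.
    rewrite -ij; case: eqP => [/esym/val_inj/eqP|_]; first by rewrite (negbTE ik).
    by rewrite conjC0 mulr0.
  rewrite -ik mulr1n /s'; case: ltnP => [iN|nI].
    rewrite (bigD1 (Ordinal iN))//= eqxx big1 => [|j jN].
      by rewrite addr0 conjC_realC expr2.
    rewrite (_ : (i == j :> nat) = false) ?mul0r//.
    by apply: contra_neqF jN => /eqP ij; apply: val_inj.
  rewrite expr0n/= big1// => j _; rewrite (_ : (i == j :> nat) = false) ?mul0r//.
  by apply/negbTE; rewrite neq_ltn (leq_trans (ltn_ord j) nI) orbT.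
apply/matrixP => i j; rewrite !ord1 mul_diag_mx !mxE; apply: eq_bigr => k _.
by rewrite !mxE conjC_mulC conjC_realC; ring.
Qed.


Lemma svd_norm_adj_ge (c : R) (a : 'cV[C]_m) : 0 <= c ->
  (forall i : 'I_m, a i 0 != 0 -> c <= s' i) ->
  c * norm2 a <= norm2 (H ^t* *m (U *m a)).
Proof.
move=> c0 ca; rewrite -(@ler_pXn2r _ 2)// ?nnegrE ?mulr_ge0 ?norm2_ge0//.
rewrite svd_norm2_adj svd_coordK exprMn norm2_sqr mulr_sumr.
apply: ler_sum => i _; have [->|ai] := eqVneq (a i 0) 0.
  by rewrite normc0 expr0n/= !mulr0.
by rewrite ler_wpM2r ?sqr_ge0// lerXn2r ?nnegrE ?ca.
Qed.

Lemma svd_norm_adj_le (c : R) (a : 'cV[C]_m) : 0 <= c ->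
  (forall i : 'I_m, a i 0 != 0 -> s' i <= c) ->
  norm2 (H ^t* *m (U *m a)) <= c * norm2 a.
Proof.
move=> c0 ca; rewrite -(@ler_pXn2r _ 2)// ?nnegrE ?mulr_ge0 ?norm2_ge0//.
rewrite svd_norm2_adj svd_coordK exprMn norm2_sqr mulr_sumr.
apply: ler_sum => i _; have [->|ai] := eqVneq (a i 0) 0.
  by rewrite normc0 expr0n/= !mulr0.
by rewrite ler_wpM2r ?sqr_ge0// lerXn2r ?nnegrE ?ca.
Qed.

(* Courant-Fischer, one direction each: dimension counting yields a common
   nonzero vector of range Phi and of the span of the trailing (resp. of the
   orthogonal of range Phi and of the span of the leading) singular vectors. *)
Lemma svd_value_ge (S : nat) (Phi : 'M[C]_(m, S)) (tau : R) : 0 <= tau ->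
  (forall c : 'cV[C]_S, Phi *m c = 0 -> c = 0) ->
  (forall c : 'cV[C]_S, tau * norm2 (Phi *m c) <= norm2 (H ^t* *m (Phi *m c))) ->
  forall i : 'I_m, (i < S)%N -> tau <= s' i.
Proof.
move=> tau0 inj ht i iS.
pose A : 'M[C]_(i, S) := \matrix_(p, q) (U ^t* *m Phi) (widen_ord (ltnW (ltn_ord i)) p) q.
have [c c0 Ac] := wide_kernel A iS.
have w0 : Phi *m c != 0 by apply: contra_neq c0 => /inj.
set a := U ^t* *m (Phi *m c).
have Ua : U *m a = Phi *m c.
  by case: hsvd => /unitarymxP UU' _ _ _ _; rewrite /a mulmxA UU' mul1mx.
have ai (k : 'I_m) : (k < i)%N -> a k 0 = 0.
  move=> ki; transitivity ((A *m c) (Ordinal ki) 0); last by rewrite Ac mxE.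
  rewrite /a mulmxA mxE [RHS]mxE; apply: eq_bigr => q _.
  by rewrite [in RHS]mxE; congr (fun_of_matrix _ _ _ * _); apply: val_inj.
have := ht c; rewrite -Ua => /le_trans/(_ (svd_norm_adj_le (s'_ge0 i) _)) h.
have na : norm2 a = norm2 (Phi *m c) by rewrite /a -svd_coord.
rewrite -(ler_pM2r (norm2_gt0 w0)) -{1}Ua -na h// => k ak.
apply: s'_decr; rewrite leqNgt; apply/negP => /ai e.
by rewrite e eqxx in ak.
Qed.

Lemma svd_value_le (S : nat) (Phi : 'M[C]_(m, S)) (t : R) : 0 <= t ->
  (forall v : 'cV[C]_m, Phi ^t* *m v = 0 -> norm2 (H ^t* *m v) <= t * norm2 v) ->
  forall i : 'I_m, (S <= i)%N -> s' i <= t.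
Proof.
move=> t0 ht i Si.
pose J : 'M[C]_(m, i.+1) := \matrix_(p, q) (p == q :> nat)%:R.
have [c c0 Ac] := wide_kernel (Phi ^t* *m U *m J) (Si : (S < i.+1)%N).
pose a := J *m c.
have aE (k : 'I_m) : a k 0 = if insub (k : nat) is Some q then c q 0 else 0.
  rewrite /a mxE; case: insubP => [q _ qk|ki].
    rewrite (bigD1 q)//= big1 => [|r rq]; rewrite mxE.
      by rewrite qk eqxx mul1r addr0.
    rewrite (_ : (_ == _) = false) ?mul0r//.
    by apply: contra_neqF rq => /eqP kr; apply: val_inj; rewrite /= qk.
  rewrite big1// => q _; rewrite mxE (_ : (_ == _) = false) ?mul0r//.
  by apply: contraNF ki => /eqP ->.
have a0 : a != 0.
  apply: contra_neq c0 => az; apply/matrixP => q j; rewrite ord1 mxE.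
  have qm : (q < m)%N by apply: leq_trans (ltn_ord q) _; exact: ltn_ord i.
  have := aE (Ordinal qm); rewrite az mxE (insubT (fun x => (x < i.+1)%N) (ltn_ord q)) => ->.
  by congr (c _ _); apply: val_inj.
have hU : Phi ^t* *m (U *m a) = 0 by rewrite /a !mulmxA.
have := ht _ hU; rewrite (svd_coord (U *m a)) svd_coordK => /(le_trans _) h.
rewrite -(ler_pM2r (norm2_gt0 a0)) h// svd_norm_adj_ge// => k ak.
apply: s'_decr; move: ak; rewrite aE; case: insubP => [q qi _ _|_]; last by rewrite eqxx.
by [].
Qed.

End svd.

(** * Deterministic perturbation of the noise space *)

Lemma quadratic_le (R : realType) (a b d : R) : 0 <= a -> 0 <= b -> 0 <= d ->
  a ^+ 2 <= a * b + a * d -> a <= b + d.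
Proof.
move=> a0 b0 d0; rewrite -mulrDr expr2.
move: a0; rewrite le_eqVlt => /predU1P[<- _|a0]; first by rewrite addr_ge0.
by rewrite ler_pM2l.
Qed.

Section music.
Variable R : realType.
Local Notation C := R[i].
Variables (L n S k : nat).
Local Notation m := L.+1.
Variables (Phi : 'M[C]_(m, S)) (G : 'M[C]_(S, n)) (H : 'M[C]_(m, n)).
Variables (W : 'M[C]_(m, k)) (What : 'M[C]_(m, m - S)).
Variables (mu gam t0 : R).
Hypotheses (mu0 : 0 < mu) (gam0 : 0 < gam) (t00 : 0 <= t0).
Hypothesis hPhi : forall c, mu * norm2 c <= norm2 (Phi *m c).
Hypothesis hG : forall c, gam * norm2 c <= norm2 (G ^t* *m c).
Hypothesis hE : forall v, norm2 ((H - Phi *m G) ^t* *m v) <= t0 * norm2 v.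
Hypothesis hW : orthobasis_range_perp (Phi *m G) W.
Hypothesis hWhat : svd_noise_space H What.

Let H0 := Phi *m G.
Let tau := mu * gam.

Let Phi_inj (c : 'cV[C]_S) : Phi *m c = 0 -> c = 0.
Proof.
move=> e; apply: norm2_eq0; apply/eqP; rewrite eq_le norm2_ge0 andbT.
by rewrite -(ler_pM2l mu0) mulr0; apply: le_trans (hPhi c) _; rewrite e norm20.
Qed.

Let G_inj (c : 'cV[C]_S) : G ^t* *m c = 0 -> c = 0.
Proof.
move=> e; apply: norm2_eq0; apply/eqP; rewrite eq_le norm2_ge0 andbT.
by rewrite -(ler_pM2l gam0) mulr0; apply: le_trans (hG c) _; rewrite e norm20.
Qed.

Let H0E (v : 'cV[C]_m) : H0 ^t* *m v = G ^t* *m (Phi ^t* *m v).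
Proof. by rewrite /H0 ctrmxM mulmxA. Qed.

Let H0_ker (v : 'cV[C]_m) : H0 ^t* *m v = 0 -> Phi ^t* *m v = 0.
Proof. by rewrite H0E => /G_inj. Qed.

(** By Cauchy-Schwarz the square of |Phi c| is at most |c| times the norm of its image under the
    adjoint of [Phi], and |c| <= |Phi c| / mu. The bound in terms of coefficients thus becomes one
    in terms of the vector of the range. *)
Let Phi_gram (c : 'cV[C]_S) : mu * norm2 (Phi *m c) <= norm2 (Phi ^t* *m (Phi *m c)).
Proof.
have [->|c0] := eqVneq c 0; first by rewrite !mulmx0 !norm20 mulr0.
have nc := norm2_gt0 c0; have := hPhi c.
have := norm2_dot c (Phi ^t* *m (Phi *m c)).
rewrite mulmxA -ctrmxM norm2_mxE mxE mulr1n normc_real ger0_norm ?sqr_ge0//.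
have := norm2_ge0 (Phi *m c).
move: (norm2 (Phi *m c)) (norm2 (_ *m (_ *m c))) (norm2 c) nc => p q r r0 p0 h1 h2.
rewrite -(ler_pM2l r0); apply: le_trans h1.
by rewrite mulrCA mulrA expr2 ler_wpM2r.
Qed.

Let H0_range (c : 'cV[C]_S) : tau * norm2 (Phi *m c) <= norm2 (H0 ^t* *m (Phi *m c)).
Proof.
rewrite H0E; apply: le_trans (hG _).
by rewrite /tau mulrAC mulrC ler_wpM2l ?Phi_gram// ltW.
Qed.

Let W1 : W ^t* *m W = 1%:M. Proof. by case: hW. Qed.

Let H0W (c : 'cV[C]_k) : H0 ^t* *m (W *m c) = 0.
Proof.
case: hW => _ /(_ (W *m c)) [h _].
have {}h := h (ex_intro _ c erefl).
(* Testing orthogonality on this vector yields its own squared norm. *)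
have := h (H0 ^t* *m (W *m c)).
by rewrite ctrmxM -mulmxA norm2_mxE => /matrixP/(_ 0 0); rewrite !mxE mulr1n =>
  /complexI/eqP; rewrite sqrf_eq0 => /eqP/norm2_eq0.
Qed.

Let PhiW : Phi ^t* *m W = 0.
Proof.
apply/matrixP => i j.
have := H0_ker (H0W (delta_mx j 0)); rewrite mulmxA -colE => /matrixP/(_ i 0).
by rewrite !mxE.
Qed.

(** The least squares residual of [v] is orthogonal to the range of [Phi], hence lies in the span of
    [W]; as [W] is an isometry orthogonal to [Phi], that residual is the projection of [v] by
    [W]. *)
Let proj_range (v : 'cV[C]_m) : exists c, v - W *m (W ^t* *m v) = Phi *m c.
Proof.
have Gu : Phi ^t* *m Phi \in unitmx.
  apply: inj_unitmx => c e; apply: Phi_inj; apply: norm2_eq0; apply/eqP.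
  rewrite -sqrf_eq0; apply/eqP; apply: complexI.
  have : (Phi *m c) ^t* *m (Phi *m c) = 0 by rewrite ctrmxM -mulmxA (mulmxA (Phi ^t*)) e mulmx0.
  by rewrite norm2_mxE => /matrixP/(_ 0 0); rewrite !mxE mulr1n.
pose c := invmx (Phi ^t* *m Phi) *m (Phi ^t* *m v).
exists c; pose r := v - Phi *m c.
have r0 : Phi ^t* *m r = 0.
  by rewrite /r /c mulmxBr !mulmxA mulmxV// mul1mx subrr.
have [d rd] : exists d, r = W *m d.
  case: hW => _ /(_ r) [_]; apply=> u.
  by rewrite ctrmxM -mulmxA H0E r0 !mulmx0.
have WPhi : W ^t* *m Phi = 0.
  by rewrite -[Phi]ctrmxK -ctrmxM PhiW; apply/matrixP => i j; rewrite !mxE conjC0.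
have vE : v = r + Phi *m c by rewrite subrK.
have -> : W ^t* *m v = d.
  by rewrite vE mulmxDr (mulmxA (W ^t*) Phi) WPhi mul0mx addr0 rd mulmxA W1 mul1mx.
by rewrite -rd /r opprB addrCA subrr addr0.
Qed.

Let W_pyth (v : 'cV[C]_m) : norm2 (W ^t* *m v) <= norm2 v.
Proof.
have := norm2_dot (W *m (W ^t* *m v)) v.
rewrite ctrmxM -mulmxA norm2_mxE mxE mulr1n normc_real ger0_norm ?sqr_ge0//.
rewrite norm2_isometry//; have := norm2_ge0 (W ^t* *m v).
rewrite le_eqVlt => /predU1P[<- _|p]; first exact: norm2_ge0.
by rewrite expr2 ler_pM2l.
Qed.

Lemma music_perturbation (v : 'cV[C]_m) :
  `|norm2 (What ^t* *m v) - norm2 (W ^t* *m v)| * tau <= 2 * t0 * norm2 v.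
Proof.
case: hWhat => U [s [V [hsvd WU]]].
have UU' : U *m U ^t* = 1%:M by case: hsvd => /unitarymxP.
have UU : U ^t* *m U = 1%:M by apply: mulmx1C.
have tau0 : 0 < tau by rewrite mulr_gt0.
pose part (P : pred nat) (u : 'cV[C]_m) : 'cV[C]_m :=
  \col_i (if P i then (U ^t* *m u) i 0 else 0).
pose lo := part (fun i => (i < S)%N); pose hi := part (fun i => (S <= i)%N).
have partD u : u = U *m lo u + U *m hi u.
  rewrite -mulmxDr -[LHS]mul1mx -UU' -mulmxA; congr (_ *m _).
  apply/matrixP => i j; rewrite ord1 [RHS]mxE !mxE ltnNge.
  by case: (S <= i)%N; rewrite ?add0r ?addr0.
have part_dot P u u' : ((U *m part P u) ^t* *m u') 0 0 = (u ^t* *m (U *m part P u')) 0 0.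
  have uU : u ^t* *m U = (U ^t* *m u) ^t* by rewrite ctrmxM ctrmxK.
  rewrite ctrmxM -mulmxA (mulmxA (u ^t*)) uU [LHS]mxE [RHS]mxE.
  apply: eq_bigr => i _; rewrite !mxE.
  by case: ifP => _; rewrite ?conjC0 ?mul0r ?mulr0// !mxE.
have part_proj P u : norm2 (part P u) ^+ 2 =
    normc (((U *m part P u) ^t* *m u) 0 0).
  rewrite ctrmxM -mulmxA.
  transitivity (normc (((part P u) ^t* *m part P u) 0 0)).
    by rewrite norm2_mxE mxE mulr1n normc_real ger0_norm// sqr_ge0.
  congr normc; rewrite !mxE; apply: eq_bigr => i _; rewrite !mxE.
  by case: ifP => _; rewrite ?conjC0 ?mul0r.
have hiW u : norm2 (hi u) = norm2 (What ^t* *m u).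
  apply/eqP; rewrite -(@eqrXn2 _ 2)// ?norm2_ge0// !norm2_sqr; apply/eqP.
  pose F (j : nat) := normc ((U ^t* *m u) (inord j) 0) ^+ 2.
  transitivity (\sum_(0 <= j < m | (S <= j)%N) F j).
    rewrite big_mkord [RHS]big_mkcond/=; apply: eq_bigr => i _.
    by rewrite mxE /F inord_val; case: ifP; rewrite // normc0 expr0n.
  rewrite -(@big_nat_widenl _ _ _ S 0 m xpredT)// -{1}[S]add0n big_addn big_mkord.
  apply: eq_bigr => i _; rewrite /F !mxE; congr (normc _ ^+ 2).
  by apply: eq_bigr => p _; rewrite !mxE WU addnC.
have hi_le u : norm2 (hi u) <= norm2 u.
  have := norm2_dot (U *m hi u) u; rewrite -part_proj norm2_isometry//.
  have := norm2_ge0 (hi u).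
  rewrite le_eqVlt => /predU1P[<- _|p]; first exact: norm2_ge0.
  by rewrite expr2 ler_pM2l.
have E_adj u : norm2 (H ^t* *m u - H0 ^t* *m u) <= t0 * norm2 u.
  apply: le_trans (hE u); rewrite le_eqVlt; apply/orP; left; apply/eqP.
  by congr norm2; rewrite -mulmxBl; congr (_ *m _); apply/matrixP => i j; rewrite !mxE rmorphB.
have HE u : norm2 (H ^t* *m u) <= norm2 (H0 ^t* *m u) + t0 * norm2 u.
  by rewrite -[H ^t* *m u](subrK (H0 ^t* *m u)) addrC (le_trans (norm2D _ _))// lerD2l.
have H0E' u : norm2 (H0 ^t* *m u) <= norm2 (H ^t* *m u) + t0 * norm2 u.
  rewrite -[H0 ^t* *m u](subKr (H ^t* *m u)) (le_trans (norm2B _ _))// lerD2l.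
  exact: E_adj.
(* If 2 t0 > tau the claim is trivial, both norms lying between 0 and that of [v]. *)
have [small|big] := leP (2 * t0) tau; last first.
  have := hi_le v; rewrite hiW => h1; have h2 := W_pyth v.
  apply: (@le_trans _ _ (norm2 v * tau)).
    by rewrite ler_pM2r// ler_norml; apply/andP; split;
      have := norm2_ge0 (W ^t* *m v); have := norm2_ge0 (What ^t* *m v); lra.
  by rewrite mulrC ler_wpM2r ?norm2_ge0// ltW.
rewrite -ler_pdivlMr//.
pose dl := 2 * t0 / tau.
have dl0 : 0 <= dl by rewrite divr_ge0 ?mulr_ge0// ltW.
have -> : 2 * t0 * norm2 v / tau = dl * norm2 v by rewrite /dl mulrAC.
have dlv : 0 <= dl * norm2 v by rewrite mulr_ge0 ?norm2_ge0.
(* [p] lies in the trailing singular space, where the adjoint of [H] has norm at most [t0]; passing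
   to [H0] costs another [t0]. The component of [p] in the range of [Phi], where the adjoint of [H0]
   is at least [tau], is therefore at most [dl] times |p|. *)
have h1 : norm2 (hi v) <= norm2 (W ^t* *m v) + dl * norm2 v.
  apply: quadratic_le; rewrite ?norm2_ge0//.
  set p := U *m hi v.
  have np : norm2 p = norm2 (hi v) by rewrite norm2_isometry.
  have [c qc] := proj_range p.
  have q_le : norm2 (p - W *m (W ^t* *m p)) <= dl * norm2 (hi v).
    rewrite -np /dl mulrAC ler_pdivlMr// mulrC qc.
    apply: le_trans (H0_range c) _; rewrite -qc mulmxBr H0W subr0.
    apply: le_trans (H0E' p) _; rewrite mulr_natl mulr2n mulrDl lerD2r np.
    apply: (svd_norm_adj_le hsvd) => // i; rewrite mxE.
    case: ifP => [Si _|_]; last by rewrite eqxx.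
    apply: (@svd_value_le _ _ _ _ _ _ _ hsvd S Phi t0 t00 _ i Si) => u Pu.
    by apply: le_trans (HE u) _; rewrite H0E Pu mulmx0 norm20 add0r.
  rewrite part_proj -/p.
  have -> : p ^t* *m v = (p - W *m (W ^t* *m p)) ^t* *m v
      + (W ^t* *m p) ^t* *m (W ^t* *m v).
    have -> : (W ^t* *m p) ^t* *m (W ^t* *m v) = (W *m (W ^t* *m p)) ^t* *m v.
      by rewrite [in RHS]ctrmxM mulmxA.
    by rewrite -mulmxDl -ctrmxD subrK.
  rewrite [X in normc X]mxE.
  apply: le_trans (le_normcD _ _) _; rewrite addrC lerD//.
    apply: le_trans (norm2_dot _ _) _; rewrite ler_wpM2r ?norm2_ge0// -np.
    exact: W_pyth.
  apply: le_trans (norm2_dot _ _) _.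
  by rewrite mulrCA mulrA ler_wpM2r ?norm2_ge0.
(* The roles are exchanged: [p] is killed by the adjoint of [H0], and the leading singular values of
   [H] are at least tau - t0. *)
have h2 : norm2 (W ^t* *m v) <= norm2 (hi v) + dl * norm2 v.
  apply: quadratic_le; rewrite ?norm2_ge0//.
  set p := W *m (W ^t* *m v).
  have np : norm2 p = norm2 (W ^t* *m v) by rewrite norm2_isometry.
  have lo_le : norm2 (lo p) <= dl * norm2 p.
    have tt : 0 <= tau - t0 by lra.
    have : (tau - t0) * norm2 (lo p) <= norm2 (H ^t* *m p).
      rewrite -(@ler_pXn2r _ 2)// ?nnegrE ?mulr_ge0 ?norm2_ge0//.
      rewrite (svd_norm2_adj hsvd) exprMn norm2_sqr mulr_sumr.
      apply: ler_sum => i _; rewrite mxE; case: ifP => iS; last first.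
        by rewrite normc0 expr0n/= mulr0 mulr_ge0 ?sqr_ge0.
      rewrite ler_wpM2r ?sqr_ge0// lerXn2r ?nnegrE//.
        by case: hsvd => _ _ s0 _ _; case: ifP.
      apply: (svd_value_ge hsvd tt Phi_inj _ iS) => c.
      by rewrite mulrBl lerBlDr; apply: le_trans (H0_range c) (H0E' _).
    have := HE p; rewrite H0W norm20 add0r => /[swap] /le_trans/[apply] h.
    (* In the present case tau <= 2 (tau - t0), which replaces t0 / (tau - t0) by [dl]. *)
    rewrite /dl mulrAC ler_pdivlMr//; have := norm2_ge0 (lo p); have := norm2_ge0 p.
    nra.
  have -> : norm2 (W ^t* *m v) ^+ 2 = normc ((p ^t* *m v) 0 0).
    rewrite ctrmxM -mulmxA norm2_mxE mxE mulr1n normc_real ger0_norm ?sqr_ge0//.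
  rewrite [in leLHS](partD v) mulmxDr mxE -part_dot addrC.
  apply: le_trans (le_normcD _ _) _; rewrite lerD//.
    by apply: le_trans (norm2_dot _ _) _; rewrite np norm2_isometry.
  apply: le_trans (norm2_dot _ _) _; rewrite norm2_isometry//.
  by rewrite mulrCA mulrA -np ler_wpM2r ?norm2_ge0.
rewrite -hiW ler_norml; apply/andP; split; lra.
Qed.

End music.

(** * Roots of unity and the discrete Parseval identity *)

Section dft.
Variable R : realType.
Local Notation C := R[i].

Lemma expiD (a b : R) : expi (a + b) = expi a * expi b.
Proof. by rewrite /expi cosD sinD mulrC; congr (_ +i* _)%C; ring. Qed.

Lemma expi0 : expi 0 = 1 :> C.
Proof. by rewrite /expi cos0 sin0. Qed.

Lemma normc_expi (t : R) : normc (expi t) = 1.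
Proof. by rewrite /normc/= cos2Dsin2 sqrtr1. Qed.

Lemma expi_neq0 (t : R) : expi t != 0.
Proof.
by apply/negP => /eqP e; have := normc_expi t; rewrite e normc0 => /eqP; rewrite eq_sym oner_eq0.
Qed.

Lemma expiN (t : R) : expi (- t) = (expi t)^-1.
Proof.
by apply: (mulfI (expi_neq0 t)); rewrite -expiD subrr expi0 mulfV ?expi_neq0.
Qed.

Lemma expi_conj (t : R) : (expi t)^* = expi (- t).
Proof.
apply: (mulfI (expi_neq0 t)); rewrite -expiD subrr expi0 mulrC conjC_normc.
by rewrite normc_expi expr1n.
Qed.

Lemma expiX (t : R) n : expi t ^+ n = expi (n%:R * t).
Proof.
elim: n => [|n IH]; first by rewrite mul0r expi0.
by rewrite exprS IH -expiD -[n.+1]add1n natrD mulrDl mul1r.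
Qed.

Lemma expi2pi : expi (2 * pi) = 1 :> C.
Proof. by rewrite /expi mulr_natl cos2pi sin2pi. Qed.

Lemma expi_period (n : int) (t : R) : expi (2 * pi * (t + n%:~R)) = expi (2 * pi * t).
Proof.
suff h k : expi (2 * pi * k%:R) = 1 :> C.
  rewrite mulrDr expiD; case: n => n.
    by rewrite -pmulrn h mulr1.
  by rewrite NegzE mulrNz mulrN expiN -pmulrn h invr1 mulr1.
by rewrite mulrC -expiX expi2pi expr1n.
Qed.

Lemma normc_expiB (a b : R) : normc (expi a - expi b) = 2 * `|sin ((a - b) / 2)|.
Proof.
have -> : expi a - expi b = expi ((a + b) / 2) * (0 +i* (2 * sin ((a - b) / 2)))%C.
  rewrite /expi; set p := (a + b) / 2; set q := (a - b) / 2.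
  have -> : a = p + q by rewrite /p /q; field.
  have -> : b = p - q by rewrite /p /q; field.
  rewrite cosD cosB sinD sinB; apply/eqP; rewrite eq_complex/=.
  by apply/andP; split; apply/eqP; ring.
rewrite normcM normc_expi mul1r /normc/= expr0n add0r sqrtr_sqr normrM.
by rewrite ger0_norm.
Qed.

Lemma expi_neq1 (x : R) : 0 < `|x| < 1 -> expi (2 * pi * x) != 1 :> C.
Proof.
move=> /andP[x0 x1]; apply/negP => /eqP e.
have := normc_expiB (2 * pi * x) 0; rewrite expi0 e subrr normc0 subr0.
have -> : 2 * pi * x / 2 = pi * x by field.
move=> /esym/eqP; rewrite mulf_eq0 pnatr_eq0/= normr_eq0.
wlog xp : x x0 x1 {e} / 0 <= x.
  move=> h; have [?|?] := leP 0 x; first exact: h.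
  have := h (- x); rewrite !normrN => /(_ x0 x1); rewrite mulrN sinN oppr_eq0.
  by apply; lra.
rewrite ger0_norm// in x0 x1; apply/negP; rewrite gt_eqF// sin_gt0_pi//.
by rewrite mulr_gt0 ?pi_gt0//= gtr_pMr ?pi_gt0.
Qed.

Lemma sum_expr_root1 (u : C) n : u != 1 -> u ^+ n = 1 -> \sum_(k < n) u ^+ k = 0.
Proof.
move=> u1 un; apply: (mulfI (_ : u - 1 != 0)); first by rewrite subr_eq0.
by rewrite -subrX1 un subrr mulr0.
Qed.

Definition unit_root (n : nat) (k : nat) : C := expi (- (2 * pi * (k%:R / n%:R))).

Lemma unit_rootX n k : (0 < n)%N -> unit_root n k ^+ n = 1.
Proof.
move=> n0; rewrite expiX mulrN expiN.
have -> : n%:R * (2 * pi * (k%:R / n%:R)) = k%:R * (2 * pi) :> R.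
  by field; rewrite pnatr_eq0 -lt0n.
by rewrite -expiX expi2pi expr1n invr1.
Qed.

Lemma dft_parseval n (a : nat -> C) : (0 < n)%N ->
  \sum_(k < n) normc (\sum_(i < n) a i * unit_root n k ^+ i) ^+ 2 =
  n%:R * \sum_(i < n) normc (a i) ^+ 2.
Proof.
move=> n0; apply: complexI; rewrite rmorphM rmorph_nat !rmorph_sum/=.
transitivity (\sum_(i < n) \sum_(j < n) (a i)^* * a j *
   \sum_(k < n) expi (2 * pi * ((i%:R - j%:R) / n%:R)) ^+ k).
  under [RHS]eq_bigr do under eq_bigr do rewrite mulr_sumr.
  under [RHS]eq_bigr do rewrite exchange_big.
  rewrite [RHS]exchange_big/=; apply: eq_bigr => k _.
  rewrite -conjC_normc rmorph_sum/= mulr_suml; apply: eq_bigr => i _.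
  rewrite mulr_sumr; apply: eq_bigr => j _.
  rewrite conjC_mulC mulrACA; congr (_ * _).
  rewrite /unit_root !expiX expi_conj -expiD; congr expi; field.
  by rewrite pnatr_eq0 -lt0n.
rewrite [RHS]mulr_sumr; apply: eq_bigr => i _.
rewrite (bigD1 i)//= [X in _ + X]big1 ?addr0 => [|j ji].
  rewrite subrr mul0r mulr0 expi0; under eq_bigr do rewrite expr1n.
  by rewrite sumr_const card_ord conjC_normc mulrC.
rewrite sum_expr_root1 ?mulr0//.
  apply: expi_neq1; rewrite normr_gt0 mulf_neq0 ?invr_eq0 ?pnatr_eq0 -?lt0n//=.
    rewrite normrM normfV normr_nat ltr_pdivrMr ?ltr0n// mul1r.
    have := ltn_ord i; have := ltn_ord j; rewrite -!(ltr_nat R) => ? ?.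
    by rewrite ltr_norml; apply/andP; split; have := ler0n R i; have := ler0n R j; lra.
  by rewrite subr_eq0 eqr_nat eq_sym.
rewrite expiX.
have -> : n%:R * (2 * pi * ((i%:R - j%:R) / n%:R)) = i%:R * (2 * pi) - j%:R * (2 * pi) :> R.
  by field; rewrite pnatr_eq0 -lt0n.
have h q : expi (q%:R * (2 * pi)) = 1 :> C by rewrite -expiX expi2pi expr1n.
by rewrite expiD expiN !h invr1 mulr1.
Qed.

(** Sampling at the n-th roots of unity replaces integration over the circle; it is exact because
    the degree is below n. *)
Lemma poly_parseval n (p : {poly C}) : (size p <= n)%N -> (0 < n)%N ->
  \sum_(k < n) normc (p.[unit_root n k]) ^+ 2 =
  n%:R * \sum_(i < n) normc (p`_i) ^+ 2.
Proof.
move=> pn n0; rewrite -dft_parseval//; apply: eq_bigr => k _.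
by rewrite (horner_coef_wide _ pn).
Qed.

End dft.

(** * Norm of a real Hankel matrix through Fourier coefficients *)

Section hankel_noise.
Variable R : realType.
Local Notation C := R[i].
Variables (M L : nat) (e : 'I_M.+1 -> R).
Hypothesis LM : (L <= M)%N.

Let dft (k : nat) : C := \sum_(m < M.+1) ((e m)%:C)%C * unit_root R M.+1 k ^+ m.

(* The Hankel matrix is a corner of the anticirculant matrix with entries
   e_(p+q mod M+1), which the discrete Fourier transform diagonalizes. *)
Lemma hankel_adj_le (t0 : R) : 0 <= t0 ->
  (forall k, (k < M.+1)%N -> normc (dft k) <= t0) ->
  forall v : 'cV[C]_L.+1,
  norm2 ((Hankel L (\col_m ((e m)%:C)%C)) ^t* *m v) <= t0 * norm2 v.
Proof.
move=> t00 ht v; set H := Hankel _ _.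
pose n := M.+1; have n0 : (0 < n)%N by [].
pose vv (i : nat) : C := if (i < L.+1)%N then v (inord i) 0 else 0.
have vvE (F : nat -> C) : \sum_(p < L.+1) v p 0 * F p = \sum_(p < n) vv p * F p.
  transitivity (\sum_(p < L.+1) vv p * F p).
    by apply: eq_bigr => p _; rewrite /vv ltn_ord inord_val.
  rewrite (big_ord_widen n (fun p => vv p * F p)) ?ltnS// big_mkcond.
  by apply: eq_bigr => p _; rewrite /vv; case: ifP => pL; rewrite ?pL ?mul0r.
have vvn : \sum_(p < n) normc (vv p)^* ^+ 2 = norm2 v ^+ 2.
  rewrite norm2_sqr.
  transitivity (\sum_(p < L.+1) normc (vv p) ^+ 2).
    rewrite (big_ord_widen n (fun p => normc (vv p) ^+ 2)) ?ltnS// [RHS]big_mkcond.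
    apply: eq_bigr => p _; rewrite normc_conj /vv.
    by case: ifP => pL; rewrite ?pL ?normc0 ?expr0n.
  by apply: eq_bigr => p _; rewrite /vv ltn_ord inord_val.
pose c (q : nat) : C :=
  \sum_(p < L.+1) v p 0 * ((e (inord p + inord q))%:C)%C.
(* The sum in the index of [c] is taken modulo M+1. For q <= M - L nothing wraps around, and the
   further entries only increase the norm. *)
have Hc : norm2 (H ^t* *m v) ^+ 2 <= \sum_(q < n) normc (c q) ^+ 2.
  have -> : norm2 (H ^t* *m v) ^+ 2 = \sum_(q < (M - L).+1) normc (c q) ^+ 2.
    rewrite norm2_sqr; apply: eq_bigr => q _; congr (normc _ ^+ 2).
    rewrite mxE; apply: eq_bigr => p _; rewrite !mxE conjC_realC mulrC.
    congr (_ * ((e _)%:C)%C); apply: val_inj => /=.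
    have := ltn_ord p; have := ltn_ord q; rewrite !ltnS => qM pL.
    by rewrite !inordK ?ltnS ?modn_small//; lia.
  rewrite (big_ord_widen n (fun q => normc (c q) ^+ 2)) ?ltnS ?leq_subr//.
  rewrite big_mkcond; apply: ler_sum => q _.
  by case: ifP => _//; exact: sqr_ge0.
have step k : \sum_(q < n) c q * unit_root R n k ^+ q =
    dft k * \sum_(p < n) vv p * (unit_root R n k)^* ^+ p.
  set w := unit_root R n k.
  have ww : w^* = w^-1 by rewrite /w /unit_root expi_conj -expiN.
  have w0 : w != 0 by exact: expi_neq0.
  rewrite -vvE mulr_sumr; under eq_bigr do rewrite mulr_suml.
  rewrite exchange_big/=; apply: eq_bigr => p _.
  rewrite mulrCA; under eq_bigr do rewrite -mulrA; rewrite -mulr_sumr; congr (_ * _).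
  apply: (mulfI (expf_neq0 p w0)); rewrite mulrCA ww -exprMn mulfV// expr1n mulr1.
  have pn : (p < n)%N by apply: leq_trans (ltn_ord p) _; rewrite ltnS.
  (* Cyclic shift by p; the wraparound is invisible since w^n = 1. *)
  rewrite /dft [RHS](reindex_inj (addrI (inord p : 'I_M.+1)))/= mulr_sumr.
  apply: eq_bigr => q _; rewrite inord_val mulrCA; congr (_ * _).
  rewrite -exprD inordK// -/n -/w {1}(divn_eq (p + q) n) exprD mulnC exprM.
  by rewrite unit_rootX// expr1n mul1r.
rewrite -(@ler_pXn2r _ 2)// ?nnegrE ?mulr_ge0 ?norm2_ge0//.
apply: le_trans Hc _; rewrite -(@ler_pM2l _ n%:R) ?ltr0n//.
rewrite -(dft_parseval c)// exprMn mulrCA -vvn.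
rewrite -(dft_parseval (fun i => (vv i)^*))// mulr_sumr.
apply: ler_sum => k _; rewrite step normcM exprMn.
(* The transform of a correlation involves the conjugate root; conjugating turns it into the
   transform of the conjugate of [vv], to which Parseval was applied. *)
have -> : normc (\sum_(p < n) vv p * (unit_root R n k)^* ^+ p) =
    normc (\sum_(i < n) (vv i)^* * unit_root R n k ^+ i).
  rewrite -normc_conj rmorph_sum/=; congr normc; apply: eq_bigr => p _.
  by rewrite conjC_mulC -rmorphXn/= !conjCK.
by rewrite ler_wpM2r ?sqr_ge0// lerXn2r ?nnegrE ?normc_ge0// ht.
Qed.
End hankel_noise.

Section real_dft.
Variable R : realType.
Local Notation C := R[i].
Variables (L : nat).
Local Notation n := (L.*2.+1).

(* The constant for [i = 0], cosines for [0 < i <= L], sines for [L < i <= 2L];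
   the factor [sqrt 2] gives all of them the squared norm [2L+1]. *)
Definition real_dft_vec (i : nat) (m : nat) : R :=
  if i == 0%N then 1
  else Num.sqrt 2 * (if (i <= L)%N then cos (2 * pi * (i%:R / n%:R) * m%:R)
                     else sin (2 * pi * ((i - L)%:R / n%:R) * m%:R)).

Lemma complex_sum (I : Type) (r : seq I) (f g : I -> R) :
  \sum_(i <- r) (f i +i* g i)%C =
  ((\sum_(i <- r) f i) +i* (\sum_(i <- r) g i))%C.
Proof.
elim: r => [|i r IH]; first by rewrite !big_nil.
by rewrite !big_cons IH.
Qed.

Lemma unit_rootE k m : unit_root R n k ^+ m =
  (cos (2 * pi * (k%:R / n%:R) * m%:R) +i* - sin (2 * pi * (k%:R / n%:R) * m%:R))%C.
Proof. by rewrite /unit_root expiX /expi mulrN sinN cosN mulrC. Qed.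

(** Real part of the vanishing sum of the powers of a root of unity of index 2k, which is not 1
    since 0 < 2k < 2L+1. *)
Lemma sum_cos_eq0 (k : nat) : (0 < k <= L)%N ->
  \sum_(m < n) cos (2 * (2 * pi * (k%:R / n%:R) * m%:R)) = 0 :> R.
Proof.
move=> /andP[k0 kL]; have n0 : n%:R != 0 :> R by rewrite pnatr_eq0.
have u1 : unit_root R n k.*2 != 1.
  rewrite /unit_root -mulrN; apply: expi_neq1.
  rewrite normrN ger0_norm ?divr_ge0// divr_gt0 ?ltr0n ?double_gt0//=.
  by rewrite ltr_pdivrMr ?ltr0n// mul1r ltr_nat ltnS leq_double.
have := sum_expr_root1 u1 (unit_rootX R k.*2 (ltn0Sn _)).
under eq_bigr do rewrite unit_rootE.
rewrite complex_sum => /eqP; rewrite eq_complex => /andP[/eqP/= e _].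
rewrite -[RHS]e; apply: eq_bigr => m _; congr cos.
have -> : (k.*2)%:R = 2 * k%:R :> R by rewrite -mul2n natrM.
by ring.
Qed.

Lemma real_dft_vec_sqr i : (i < n)%N -> \sum_(m < n) real_dft_vec i m ^+ 2 = n%:R.
Proof.
move=> iN; rewrite /real_dft_vec; case: (posnP i) => [_|i0].
  by under eq_bigr do rewrite expr1n; rewrite sumr_const card_ord.
have cosE (x : R) : cos (2 * x) = 2 * cos x ^+ 2 - 1.
  by rewrite !mulr_natl cos_mulr2n.
under eq_bigr do rewrite exprMn sqr_sqrtr//.
case: leqP => iL.
  transitivity (\sum_(m < n) (1 + cos (2 * (2 * pi * (i%:R / n%:R) * m%:R))) : R).
    by apply: eq_bigr => m _; rewrite cosE; ring.
  by rewrite big_split/= sum_cos_eq0 ?i0// addr0 sumr_const card_ord.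
transitivity (\sum_(m < n) (1 - cos (2 * (2 * pi * ((i - L)%:R / n%:R) * m%:R))) : R).
  by apply: eq_bigr => m _; rewrite cosE sin2cos2; ring.
rewrite sumrB sum_cos_eq0 ?subn_gt0 ?iL ?subr0 ?sumr_const ?card_ord//=.
lia.
Qed.

(** Because of the factor [sqrt 2], the real and imaginary parts are each at most t0 / sqrt 2, so
    the modulus is at most t0 with no loss. Frequency 0 is real, and conjugation pairs each k > L
    with n - k <= L. *)
Lemma hankel_adj_le_real (e : 'I_n -> R) (t0 : R) : 0 <= t0 ->
  (forall i, (i < n)%N -> `|\sum_(m < n) real_dft_vec i m * e m| <= t0) ->
  forall v : 'cV[C]_L.+1,
  norm2 ((Hankel L (\col_m ((e m)%:C)%C)) ^t* *m v) <= t0 * norm2 v.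
Proof.
move=> t00 h; apply: hankel_adj_le => //; first by rewrite -addnn leq_addr.
pose dft (k : nat) : C := \sum_(m < n) ((e m)%:C)%C * unit_root R n k ^+ m.
have dftE k : dft k = ((\sum_(m < n) cos (2 * pi * (k%:R / n%:R) * m%:R) * e m)
    +i* (- \sum_(m < n) sin (2 * pi * (k%:R / n%:R) * m%:R) * e m))%C.
  rewrite -sumrN -complex_sum; apply: eq_bigr => m _; rewrite unit_rootE.
  by apply/eqP; rewrite eq_complex/=; apply/andP; split; apply/eqP; ring.
have low k : (k <= L)%N -> normc (dft k) <= t0.
  move=> kL; rewrite dftE; have [->|k0] := posnP k.
    rewrite [X in - X]big1 => [|m _]; last by rewrite mul0r mulr0 mul0r sin0 mul0r.
    rewrite oppr0 normc_real; have := h 0%N (ltn0Sn _).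
    rewrite /real_dft_vec/=; under eq_bigr do rewrite mul1r.
    under [in X in _ -> X]eq_bigr do rewrite mul0r mulr0 mul0r cos0 mul1r.
    by [].
  rewrite /normc/= sqrrN -[leRHS]ger0_norm// -sqrtr_sqr ler_wsqrtr//.
  set x := \sum_(m < n) _; set y := \sum_(m < n) _.
  have k1 : (k < n)%N by lia.
  have kL1 : (k + L < n)%N by lia.
  have hc : Num.sqrt 2 * `|x| <= t0.
    apply: le_trans (h k k1); rewrite -[X in X * _]ger0_norm ?sqrtr_ge0//.
    rewrite -normrM mulr_sumr le_eqVlt; apply/orP; left; apply/eqP.
    congr `|_|; apply: eq_bigr => m _.
    by rewrite /real_dft_vec eqn0Ngt k0/= kL mulrA.
  have hs : Num.sqrt 2 * `|y| <= t0.
    apply: le_trans (h _ kL1); rewrite -[X in X * _]ger0_norm ?sqrtr_ge0//.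
    rewrite -normrM mulr_sumr le_eqVlt; apply/orP; left; apply/eqP.
    congr `|_|; apply: eq_bigr => m _.
    rewrite /real_dft_vec addn_eq0 eqn0Ngt k0/= addnK mulrA.
    by rewrite (_ : (k + L <= L)%N = false)//; lia.
  have sq z : Num.sqrt 2 * `|z| <= t0 -> 2 * z ^+ 2 <= t0 ^+ 2.
    move=> hz; rewrite -[2]sqr_sqrtr// -[z ^+ 2]real_normK ?num_real// -exprMn.
    by rewrite lerXn2r ?nnegrE ?mulr_ge0 ?sqrtr_ge0.
  by have := sq _ hc; have := sq _ hs; lra.
move=> k kn; case: (leqP k L) => [|Lk]; first exact: low.
rewrite -/(dft k) (_ : dft k = (dft (n - k)%N)^*) ?normc_conj ?low//; last first.
  rewrite /dft rmorph_sum/=; apply: eq_bigr => m _.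
  rewrite conjC_mulC conjC_realC; congr (_ * _).
  rewrite /unit_root !expiX expi_conj [in RHS]mulrN [in RHS]opprK.
  have -> : (n - k)%N%:R = n%:R - k%:R :> R by rewrite natrB// ltnW.
  have -> : m%:R * (2 * pi * ((n%:R - k%:R) / n%:R)) =
     m%:R * (2 * pi) + m%:R * - (2 * pi * (k%:R / n%:R)) :> R.
    have : n%:R != 0 :> R by rewrite pnatr_eq0.
    by move: (n%:R : R) => N N0; field.
  by rewrite expiD -[expi (_ * (2 * pi))]expiX expi2pi expr1n mul1r.
by move: Lk kn; lia.
Qed.

End real_dft.

Section hankel_tail.
Context d (T : measurableType d) (R : realType) (P : probability T R).
Local Notation C := R[i].
Variables (L : nat) (sigma : R) (eta : 'I_(L.*2.+1) -> {RV P >-> R}).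
Hypotheses (s0 : 0 < sigma) (heta : gaussian_vector sigma eta).

(** Union bound over the 2L+1 real coefficients, whose common variance is sigma^2 (2L+1). *)
Lemma gaussian_hankel_tail (t0 : R) : 0 < t0 ->
  exists E : set T, [/\ measurable E,
    forall t, E t -> forall v : 'cV[C]_L.+1,
      norm2 ((Hankel L (\col_m ((eta m t)%:C)%C)) ^t* *m v) <= t0 * norm2 v &
    ((1 - (L.*2.+1)%:R * (2 * expR (- (t0 ^+ 2 / (2 * sigma ^+ 2 * (L.*2.+1)%:R)))))%:E
      <= P E)%E].
Proof.
move=> t00; set n := L.*2.+1; set b := 2 * expR _.
pose B (i : nat) := [set t | (t0 <= `|\sum_(m < n) real_dft_vec R L i m * eta m t|)%R].
have tail (i : nat) : (i < n)%N -> measurable (B i) /\ (P (B i) <= b%:E)%E.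
  move=> iN; apply: (gaussian_tail_norm s0 heta) => //.
  by rewrite real_dft_vec_sqr.
have mB (i : 'I_n) : measurable (B i) by case: (tail i (ltn_ord i)).
pose U := \big[setU/set0]_(i < n) B i.
have mU : measurable U by apply: bigsetU_measurable => i _.
exists (~` U); split; first exact: measurableC.
  move=> t Ut; apply: hankel_adj_le_real; first exact: ltW.
  move=> i iN; rewrite leNgt; apply/negP => bad; apply: Ut.
  by rewrite /U -bigcup_mkord; exists i => //; rewrite /B/= ltW.
rewrite probability_setC// EFinB leeB//.
have -> : n%:R * b = \sum_(i < n) b by rewrite sumr_const card_ord mulr_natl.
rewrite -sumEFin.
apply: (@le_trans _ _ (\sum_(i < n) P (B i))%E).
  by apply: Boole_inequality => i iN; case: (tail i iN).
by apply: lee_sum => i _; case: (tail i (ltn_ord i)).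
Qed.

End hankel_tail.

(** * Duality with polynomials, and Dirichlet kernels *)

Section interpolation.
Variable R : realType.
Local Notation C := R[i].

(* Pairing [Phi c] with the coefficients of [f j] returns [c_j] up to the values
   of [f j] at the other nodes. *)
Lemma dual_lower_bound (S L : nat) (z : 'I_S -> C) (f : 'I_S -> {poly C})
    (theta : R) (F : 'I_S -> R) (Phi : 'M[C]_(L.+1, S)) :
  (forall m j, Phi m j = z j ^+ m) ->
  0 <= theta <= 1 ->
  (forall j, (size (f j) <= L.+1)%N) ->
  (forall j, (f j).[z j] = 1) ->
  (forall j k, k != j -> normc (f j).[z k] <= theta / S%:R) ->
  (forall j, \sum_(i < L.+1) normc (f j)`_i ^+ 2 <= F j) ->
  forall c : 'cV[C]_S,
  (1 - theta) ^+ 2 * norm2 c ^+ 2 <= norm2 (Phi *m c) ^+ 2 * \sum_j F j.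
Proof.
move=> hPhi /andP[th0 th1] szf fz fzk fF c.
have F0 j : 0 <= F j by apply: le_trans (fF j); apply: sumr_ge0 => i _; exact: sqr_ge0.
have [->|c0] := eqVneq c 0.
  by rewrite norm20 expr0n/= mulr0 mulr_ge0 ?sqr_ge0 ?sumr_ge0.
have nc := norm2_gt0 c0.
have S0 : (0 < S)%N.
  case: S c c0 {z f F Phi hPhi szf fz fzk fF F0 nc} => // c c0.
  by move: c0; rewrite (_ : c = 0) ?eqxx//; apply/matrixP => -[].
set u := Phi *m c; set X := \sum_k normc (c k 0).
have pair j : \sum_(i < L.+1) (f j)`_i * u i 0 = \sum_k c k 0 * (f j).[z k].
  under [RHS]eq_bigr do rewrite (horner_coef_wide _ (szf j)) mulr_sumr.
  rewrite exchange_big; apply: eq_bigr => i _; rewrite mxE mulr_sumr.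
  by apply: eq_bigr => k _; rewrite hPhi; ring.
have cj j : normc (c j 0) <= theta / S%:R * X + Num.sqrt (F j) * norm2 u.
  have -> : c j 0 = \sum_(i < L.+1) (f j)`_i * u i 0
      - \sum_(k | k != j) c k 0 * (f j).[z k].
    by rewrite pair (bigD1 j)//= fz mulr1 addrK.
  apply: le_trans (le_normcD _ _) _; rewrite normcN addrC lerD//.
    apply: le_trans (normc_sum _ _ _) _; rewrite /X mulr_sumr [leRHS](bigID (fun k => k != j))/=.
    rewrite -[leLHS]addr0 lerD//.
      apply: ler_sum => k kj; rewrite normcM mulrC ler_wpM2r ?normc_ge0//.
      exact: fzk.
    by apply: sumr_ge0 => k _; rewrite mulr_ge0 ?divr_ge0 ?normc_ge0.
  apply: le_trans (normc_sum _ _ _) _.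
  rewrite -(@ler_pXn2r _ 2)// ?nnegrE ?mulr_ge0 ?sqrtr_ge0 ?norm2_ge0 ?sumr_ge0//; last first.
    by move=> i _; exact: normc_ge0.
  under eq_bigr do rewrite normcM.
  apply: le_trans (cauchy_schwarz_sum _ _ _) _.
  by rewrite exprMn sqr_sqrtr// -norm2_sqr ler_wpM2r ?sqr_ge0.
have X2 : X ^+ 2 <= S%:R * norm2 c ^+ 2.
  have := cauchy_schwarz_sum xpredT (fun=> 1) (fun k => normc (c k 0)).
  under eq_bigr do rewrite mul1r; move=> /le_trans; apply.
  by rewrite -norm2_sqr; under eq_bigr do rewrite expr1n; rewrite sumr_const card_ord.
have CF : \sum_j normc (c j 0) * Num.sqrt (F j) <= norm2 c * Num.sqrt (\sum_j F j).
  rewrite -(@ler_pXn2r _ 2)// ?nnegrE ?mulr_ge0 ?sqrtr_ge0 ?sumr_ge0//; last first.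
    by move=> j _; rewrite mulr_ge0 ?normc_ge0 ?sqrtr_ge0.
  apply: le_trans (cauchy_schwarz_sum _ _ _) _; rewrite -norm2_sqr exprMn.
  rewrite ler_wpM2l ?sqr_ge0// sqr_sqrtr ?sumr_ge0//.
  by under eq_bigr do rewrite sqr_sqrtr//.
have SF0 : 0 <= \sum_j F j by rewrite sumr_ge0.
(* [cj] multiplied by |c_j| and summed over j: the cross terms add up to theta / S times X^2, at
   most theta |c|^2 by [X2]. This is why the hypothesis on the other nodes carries 1/S. *)
have main : norm2 c ^+ 2 <= theta * norm2 c ^+ 2 + norm2 c * (Num.sqrt (\sum_j F j) * norm2 u).
  rewrite {1}norm2_sqr.
  apply: (@le_trans _ _ (\sum_j (theta / S%:R * X * normc (c j 0) + (normc (c j 0) * Num.sqrt (F j)) * norm2 u))).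
    apply: ler_sum => j _; rewrite expr2.
    have := ler_wpM2l (normc_ge0 (c j 0)) (cj j).
    move/le_trans; apply; rewrite le_eqVlt; apply/orP; left; apply/eqP; ring.
  rewrite big_split/= -mulr_sumr -mulr_suml -/X lerD//.
    rewrite -mulrA -expr2 -mulrA ler_wpM2l// mulrC ler_pdivrMr ?ltr0n// mulrC.
    exact: X2.
  by rewrite mulrA ler_wpM2r ?norm2_ge0.
have : (1 - theta) * norm2 c <= Num.sqrt (\sum_j F j) * norm2 u.
  rewrite -(ler_pM2l nc); move: main; rewrite expr2; lra.
rewrite -(@ler_pXn2r _ 2)// ?nnegrE ?mulr_ge0 ?sqrtr_ge0 ?norm2_ge0 ?subr_ge0//.
by rewrite !exprMn (sqr_sqrtr SF0) => h; rewrite [leRHS]mulrC.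
Qed.

(** A geometric sum in z / w, normalized to take the value 1 at z = w. *)
Definition dirichlet (q : nat) (w : C) : {poly C} :=
  (q.+1%:R)^-1 *: \poly_(i < q.+1) (w^-1 ^+ i).

Lemma size_dirichlet q w : (size (dirichlet q w) <= q.+1)%N.
Proof. exact: leq_trans (size_scale_leq _ _) (size_poly _ _). Qed.

Lemma horner_dirichlet q w z : (dirichlet q w).[z] = q.+1%:R^-1 * \sum_(i < q.+1) (z / w) ^+ i.
Proof.
rewrite /dirichlet hornerZ horner_poly; congr (_ * _); apply: eq_bigr => i _.
by rewrite exprMn mulrC.
Qed.

Lemma dirichlet_center q w : w != 0 -> (dirichlet q w).[w] = 1.
Proof.
move=> w0; rewrite horner_dirichlet mulfV//.
under eq_bigr do rewrite expr1n.
by rewrite sumr_const card_ord mulVf// pnatr_eq0.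
Qed.

Lemma normc_natV q : normc (q.+1%:R^-1 : C) = q.+1%:R^-1.
Proof.
rewrite normcV; congr (_^-1).
by rewrite -(rmorph_nat (real_complex R)) normc_real ger0_norm.
Qed.

Lemma dirichlet_le1 q w z : normc w = 1 -> normc z = 1 ->
  normc (dirichlet q w).[z] <= 1.
Proof.
move=> w1 z1; rewrite horner_dirichlet normcM normc_natV.
rewrite ler_pdivrMl ?ltr0n// mulr1; apply: le_trans (normc_sum _ _ _) _.
under eq_bigr do rewrite normcX normcM normcV w1 z1 invr1 mulr1 expr1n.
by rewrite sumr_const card_ord.
Qed.

(** Multiplication by z / w - 1 telescopes the geometric sum into a difference of two numbers of
    modulus 1. *)
Lemma dirichlet_decay q w z : normc w = 1 -> normc z = 1 ->
  normc (dirichlet q w).[z] * (q.+1%:R * normc (z - w)) <= 2.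
Proof.
move=> w1 z1; rewrite horner_dirichlet normcM normc_natV.
have w0 : w != 0 by apply/negP => /eqP w0; move: w1; rewrite w0 normc0 => /eqP; rewrite eq_sym oner_eq0.
rewrite mulrACA mulVf ?pnatr_eq0// mul1r -normcM.
set s := \sum_(_ < _) _.
have -> : s * (z - w) = w * ((z / w - 1) * s) by field.
rewrite -subrX1.
rewrite normcM w1 ?mul1r ?mulr1.
apply: le_trans (le_normcD _ _) _.
by rewrite normcN normcX normcM normcV w1 z1 invr1 mulr1 expr1n normc1.
Qed.

Lemma dirichlet_coef q w n : normc w = 1 -> (q < n)%N ->
  \sum_(i < n) normc (dirichlet q w)`_i ^+ 2 = q.+1%:R^-1.
Proof.
move=> w1 qn.
transitivity (\sum_(i < q.+1) (q.+1%:R^-1 ^+ 2 : R)).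
  rewrite (big_ord_widen n (fun=> q.+1%:R^-1 ^+ 2))// [RHS]big_mkcond.
  apply: eq_bigr => i _; rewrite coefZ coef_poly; case: ifP => iq; rewrite ?iq.
    by rewrite normcM normc_natV normcX normcV w1 invr1 expr1n mulr1.
  by rewrite mulr0 normc0 expr0n.
by rewrite sumr_const card_ord -[LHS]mulr_natl expr2 mulVKf// pnatr_eq0.
Qed.

(** By Parseval, a factor bounded by [B] on the unit circle costs at most B^2 in the squared
    coefficient norm, so the kernel alone supplies the decay 1 / (q+1). *)
Lemma coef_norm_mul_dirichlet (g : {poly C}) (B : R) q w n :
  normc w = 1 -> (q < n)%N -> (size (g * dirichlet q w)%R <= n)%N -> 0 <= B ->
  (forall z, normc z = 1 -> normc g.[z] <= B) ->
  \sum_(i < n) normc (g * dirichlet q w)`_i ^+ 2 <= B ^+ 2 / q.+1%:R.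
Proof.
move=> w1 qn sz B0 gB; have n0 : (0 < n)%N by apply: leq_ltn_trans qn.
rewrite -(ler_pM2l (_ : 0 < n%:R)) ?ltr0n// -poly_parseval//.
rewrite mulrCA -(dirichlet_coef w1 qn) -poly_parseval//; last first.
  exact: leq_trans (size_dirichlet _ _) qn.
rewrite mulr_sumr; apply: ler_sum => k _; rewrite hornerM normcM exprMn.
by rewrite ler_wpM2r ?sqr_ge0// lerXn2r ?nnegrE ?normc_ge0// gB// normc_expi.
Qed.

End interpolation.

(** * Distances on the torus and the worst spacing *)

Section torus.
Variable R : realType.
Local Notation C := R[i].

Lemma normT_le (x : R) (n : int) : normT x <= `|x - n%:~R|.
Proof.
by apply: ge_inf; [exists 0 => _ [k _ <-]; exact: normr_ge0|exists n].
Qed.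

Lemma normc_expi_sin (x : R) : normc (expi (2 * pi * x) - 1) = 2 * `|sin (pi * x)|.
Proof.
have := normc_expiB (2 * pi * x) 0; rewrite expi0 subr0 => ->; congr (2 * `|sin _|); by field.
Qed.

Lemma normT_sin (x : R) : 2 * normT x <= `|sin (pi * x)|.
Proof.
(* A nearest integer to [x], which brings [y] into the range of Jordan's inequality. *)
pose n := Num.floor (x + 2^-1); pose y := x - n%:~R.
have yh : `|y| <= 2^-1.
  have /andP[] := floor_itv (x + 2^-1).
  rewrite -/n intrD => h1 h2.
  by rewrite ler_norml /y; apply/andP; split; move: h1 h2; rewrite ?mulr1z; lra.
have -> : `|sin (pi * x)| = `|sin (pi * y)|.
  apply: (@mulfI _ 2); first by rewrite pnatr_eq0.
  rewrite -!normc_expi_sin; congr (normc (_ - 1)).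
  by rewrite -(expi_period n y) /y subrK.
apply: le_trans (jordan_sin yh); rewrite ler_pM2l//.
exact: normT_le.
Qed.

End torus.

Section spacing.
Variable R : realType.

Lemma sorted_spacing (s : seq R) (dl : R) : 0 <= dl ->
  (forall i, (i.+1 < size s)%N -> dl <= s`_i.+1 - s`_i) ->
  forall i j, (i <= j)%N -> (j < size s)%N -> (j%:R - i%:R) * dl <= s`_j - s`_i.
Proof.
move=> dl0 step i; elim=> [|j IH] ij jS.
  by move: ij; rewrite leqn0 => /eqP ->; rewrite !subrr mul0r.
move: ij; rewrite leq_eqVlt => /predU1P[->|ij]; first by rewrite !subrr mul0r.
have := IH ij (ltnW jS); have := step j jS.
by rewrite -[j.+1]addn1 natrD addn1; lra.
Qed.

(** Once sorted, the points of ranks i and j are at least |i - j| dl apart, so equal spacing is the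
    worst case. This is the origin of the sum in [Cconst]. *)
Lemma sum_prod_invr_spacing (I : finType) (A : {set I}) (x : I -> R) (dl : R) :
  0 < dl -> (forall j k, j \in A -> k \in A -> k != j -> dl <= `|x j - x k|) ->
  \sum_(j in A) \prod_(k in A | k != j) (1 / (x j - x k) ^+ 2) <=
  (dl ^- 2) ^+ #|A|.-1 * \sum_(1 <= j < #|A|.+1)
     \prod_(1 <= k < #|A|.+1 | k != j) (1 / (j%:R - k%:R) ^+ 2).
Proof.
move=> dl0 sep.
pose r := relpre x <=%O; pose s := sort r (enum A).
have rtot : total r by move=> j k; exact: le_total.
have sA : perm_eq s (enum A) by rewrite perm_sort.
have su : uniq s by rewrite (perm_uniq sA) enum_uniq.
have sS : size s = #|A| by rewrite size_sort -cardE.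
have smem j : (j \in s) = (j \in A) by rewrite (perm_mem sA) mem_enum.
have [A0|[j0 j0A]] := set_0Vmem A.
  by rewrite A0 cards0 big_set0 big_geq// mulr0.
have sorted_s : sorted r s by exact: sort_sorted.
pose y := [seq x j | j <- s].
have yE i : (i < #|A|)%N -> y`_i = x (nth j0 s i).
  by move=> iA; rewrite (nth_map j0) ?sS.
have sp i j : (i <= j)%N -> (j < #|A|)%N -> (j%:R - i%:R) * dl <= y`_j - y`_i.
  move=> ij jA; apply: sorted_spacing; rewrite ?ltW ?size_map ?sS// => k kA.
  have kA' : (k < #|A|)%N by exact: ltnW.
  rewrite !yE//.
  have le_k : x (nth j0 s k) <= x (nth j0 s k.+1).
    by have /(sortedP j0) h := sorted_s; apply: h; rewrite sS.
  rewrite -[leRHS]ger0_norm ?subr_ge0// sep -?smem ?mem_nth ?sS//.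
  by rewrite nth_uniq ?sS// neq_ltn ltnSn.
have spn i j : (i < #|A|)%N -> (j < #|A|)%N -> i != j ->
    1 / (y`_i - y`_j) ^+ 2 <= dl ^- 2 * (1 / (i.+1%:R - j.+1%:R) ^+ 2).
  wlog ij : i j / (i < j)%N.
    move=> h iA jA; rewrite neq_ltn => /orP[ij|ij]; first by apply: h; rewrite // neq_ltn ij.
    rewrite -(sqrrN (y`_i - _)) -(sqrrN (i.+1%:R - _)) !opprB.
    by apply: h; rewrite // neq_ltn ij.
  move=> iA jA _; rewrite !div1r -invfM -exprMn.
  have h := sp i j (ltnW ij) jA.
  have p : 0 < (j%:R - i%:R) * dl by rewrite mulr_gt0// subr_gt0 ltr_nat.
  rewrite -(sqrrN (y`_i - _)) opprB.
  rewrite -(sqrrN (dl * _)) -mulrN opprB !mulrS opprD addrACA subrr add0r (mulrC dl).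
  rewrite lef_pV2 ?posrE ?exprn_gt0 ?(lt_le_trans p)//.
  by rewrite lerXn2r ?nnegrE// ?ltW// (lt_le_trans p).
have sumA (F : I -> R) : \sum_(j in A) F j = \sum_(i < #|A|) F (nth j0 s i).
  by rewrite -big_enum -(perm_big _ sA) (big_nth j0) big_mkord sS.
have prodA (F : I -> R) (P : pred I) : \prod_(j in A | P j) F j =
    \prod_(i < #|A| | P (nth j0 s i)) F (nth j0 s i).
  by rewrite -big_enum_cond -(perm_big _ sA) (big_nth j0) big_mkord sS.
rewrite sumA big_add1 big_mkord mulr_sumr; apply: ler_sum => i _.
rewrite prodA big_add1 big_mkord.
have -> : (dl ^- 2) ^+ #|A|.-1 = \prod_(k < #|A| | k.+1 != i.+1) dl ^- 2.
  rewrite prodr_const; congr (_ ^+ _); rewrite -[in LHS](card_ord #|A|) -(cardC1 i).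
  by apply: eq_card => k; rewrite !inE.
rewrite -big_split/= (eq_bigl (fun k : 'I__ => k.+1 != i.+1)); last first.
  by move=> k; rewrite nth_uniq ?sS// eqSS.
apply: ler_prod => k; rewrite eqSS => ki; rewrite mul1r invr_ge0 sqr_ge0/=.
have := @spn i k (ltn_ord i) (ltn_ord k).
by rewrite [in X in X -> _]eq_sym => /(_ ki); rewrite !yE// mul1r.
Qed.

End spacing.

(** * Lagrange polynomials of a clump and their size *)

Section lagrange.
Variable R : realType.
Local Notation C := R[i].
Variables (I : finType) (A : {set I}) (Q : nat) (z : I -> C).

(** The Lagrange polynomial of the Q-th powers of the nodes, composed with X^Q. *)
Definition lagrange (j : I) : {poly C} :=
  \prod_(k in A | k != j) ((z j ^+ Q - z k ^+ Q)^-1 *: ('X^Q - (z k ^+ Q)%:P)).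

Definition lagrange_bound (j : I) : R :=
  \prod_(k in A | k != j) (2 / normc (z j ^+ Q - z k ^+ Q)).

Lemma lagrange_bound_ge0 j : 0 <= lagrange_bound j.
Proof. by apply: prodr_ge0 => k _; rewrite divr_ge0 ?normc_ge0. Qed.

Lemma lagrange_center j : (forall k, k \in A -> k != j -> z k ^+ Q != z j ^+ Q) ->
  (lagrange j).[z j] = 1.
Proof.
move=> h; rewrite horner_prod big1// => k /andP[kA kj].
by rewrite hornerZ hornerD hornerN hornerXn hornerC mulVf// subr_eq0 eq_sym h.
Qed.

Lemma lagrange_other j k : k \in A -> k != j -> (lagrange j).[z k] = 0.
Proof.
move=> kA kj; rewrite horner_prod (bigD1 k) ?kA//= hornerZ hornerD hornerN.
by rewrite hornerXn hornerC subrr mulr0 mul0r.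
Qed.

Lemma size_lagrange j : j \in A -> (size (lagrange j) <= (Q * #|A|.-1).+1)%N.
Proof.
move=> jA; apply: leq_trans (size_prod_leq _ _) _.
have cA : #|[pred k | (k \in A) && (k != j)]| = #|A|.-1.
  by rewrite (cardsD1 j A) jA; apply: eq_card => k; rewrite !inE andbC.
rewrite leq_subLR.
apply: (@leq_trans (\sum_(k in A | k != j) Q.+1).+1).
  rewrite ltnS; apply: leq_sum => k _; apply: leq_trans (size_scale_leq _ _) _.
  apply: leq_trans (size_polyD _ _) _; rewrite size_polyXn size_polyN geq_max leqnn/=.
  by apply: leq_trans (size_polyC_leq1 _) _.
by rewrite sum_nat_const cA addnS mulnC mulSn.
Qed.

Lemma lagrange_le j w : (forall k, normc (z k) = 1) -> normc w = 1 ->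
  normc (lagrange j).[w] <= lagrange_bound j.
Proof.
move=> z1 w1; rewrite horner_prod normc_prod; apply: ler_prod => k _.
rewrite normc_ge0/= hornerZ hornerD hornerN hornerXn hornerC normcM normcV mulrC.
rewrite ler_wpM2r ?invr_ge0 ?normc_ge0//.
apply: le_trans (le_normcD _ _) _.
by rewrite normcN !normcX w1 z1 expr1n.
Qed.

End lagrange.

Lemma leq_double_divn (a L : nat) : (0 < a)%N -> (a <= L)%N ->
  (L <= 2 * a * (L %/ a))%N.
Proof.
move=> a0 aL; rewrite -mulnA mul2n -addnn mulnC.
apply/ltnW/(leq_trans (ltn_ceil L a0)); rewrite mulSn leq_add2r.
by rewrite leq_pmull// divn_gt0.
Qed.

Section clump.
Variable R : realType.
Local Notation C := R[i].
Variables (S L : nat) (alpha : R) (omega : 'I_S -> R) (A : {set 'I_S}) (t : R).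
Hypothesis alpha0 : 0 < alpha.
Hypothesis sep : forall j k, j \in A -> k \in A -> k != j ->
  alpha / L%:R <= normT (omega j - omega k).
Hypothesis arc : forall j, j \in A -> in_open_arc t (L%:R^-1) (omega j).
Hypothesis A0 : (0 < #|A|)%N.
Hypothesis AL : (#|A| <= L)%N.

Let lam := #|A|.
Let Q := (L %/ lam)%N.
Definition node (w : R) : C := expi (- (2 * pi * w)).
Let z (j : 'I_S) := node (omega j).
Let s2 : R := 1 - pi ^+ 2 / (3 * lam%:R ^+ 2).

Lemma normc_node w : normc (node w) = 1. Proof. exact: normc_expi. Qed.

Lemma normc_nodeB (n : nat) (a b : R) :
  normc (node a ^+ n - node b ^+ n) = 2 * `|sin (pi * (n%:R * (b - a)))|.
Proof.
by rewrite /node !expiX normc_expiB; congr (2 * `|sin _|); field.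
Qed.

Let L0 : (0 < L)%N. Proof. exact: leq_trans A0 AL. Qed.
Let LR : 0 < L%:R :> R. Proof. by rewrite ltr0n. Qed.

Let Q0 : (0 < Q)%N. Proof. by rewrite divn_gt0. Qed.

(** In one real interval of length 1/L, differences within the clump are below 1/L; they keep the
    separation because [normT] is an infimum over integer shifts. *)
Let lifts : exists x : 'I_S -> R, forall j, j \in A ->
  t < x j < t + L%:R^-1 /\ exists n : int, x j = omega j + n%:~R.
Proof.
have h j : exists y : R, j \in A -> t < y < t + L%:R^-1 /\ exists n : int, y = omega j + n%:~R.
  have [jA|jA] := boolP (j \in A); last by exists 0.
  by have [n hn] := arc jA; exists (omega j + n%:~R) => _; split => //; exists n.
by have [x hx] := choice h; exists x.
Qed.

(** The worst case is lam = 2, where pi < 3.4 gives pi^2 / 12 <= 27/28. *)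
Lemma sinc_ge : (1 < lam)%N -> 1 <= 28 * s2.
Proof.
move=> l2; have pi0 := @pi_gt0 R; have pi3 := @pi_lt R.
have l4 : 4 <= lam%:R ^+ 2 :> R by rewrite -natrX ler_nat (leq_sqr 2).
have : pi ^+ 2 / (3 * lam%:R ^+ 2) <= 27 / 28 :> R.
  rewrite ler_pdivrMr; last by lra.
  by nra.
by rewrite /s2; lra.
Qed.

Lemma sinc_gt0 : (1 < lam)%N -> 0 < s2.
Proof. by move=> /sinc_ge; lra. Qed.

Let z_sin (x : 'I_S -> R) j k : (exists n : int, x j = omega j + n%:~R) ->
  (exists n : int, x k = omega k + n%:~R) ->
  normc (z j ^+ Q - z k ^+ Q) = 2 * `|sin (pi * (Q%:R * (x k - x j)))|.
Proof.
have zx i (n : int) : z i = node (omega i + n%:~R).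
  by rewrite /z /node !expiN expi_period.
by move=> [m ->] [n ->]; rewrite (zx j m) (zx k n) normc_nodeB.
Qed.

Let lam_gt1 j k : j \in A -> k \in A -> k != j -> (1 < lam)%N.
Proof.
move=> jA kA kj; rewrite /lam (cardsD1 j) jA (cardsD1 k) !inE kj kA//.
Qed.

Let QLlam : Q%:R * lam%:R <= L%:R :> R.
Proof. by rewrite -natrM ler_nat leq_trunc_div. Qed.

(** Since Q lam <= L and the lifts differ by at most 1/L, the angles pi Q |x k - x j| stay below pi
    / lam, in the range of [sin_sqr_ge]: each squared sine loses only the factor [s2]. *)
Let z_lower : exists2 x : 'I_S -> R,
  (forall j k, j \in A -> k \in A -> k != j -> alpha / L%:R <= `|x j - x k|) &
  (forall j k, j \in A -> k \in A -> k != j ->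
     (2 / normc (z j ^+ Q - z k ^+ Q)) ^+ 2 <=
       (1 / ((pi * Q%:R) ^+ 2 * s2)) * (1 / (x j - x k) ^+ 2) /\
     z k ^+ Q != z j ^+ Q).
Proof.
have [x hx] := lifts.
have gap j k : j \in A -> k \in A -> k != j -> alpha / L%:R <= `|x j - x k|.
  move=> jA kA kj; apply: le_trans (sep jA kA kj) _.
  have [_ [m ->]] := hx j jA; have [_ [n ->]] := hx k kA.
  have := normT_le (omega j - omega k) (n - m); rewrite intrB => /le_trans; apply.
  by rewrite le_eqVlt; apply/orP; left; apply/eqP; congr `|_|; ring.
exists x => // j k jA kA kj.
have l1 := lam_gt1 jA kA kj.
have s0 : 0 < s2 := sinc_gt0 l1.
have [/andP[j1 j2] xj] := hx j jA; have [/andP[k1 k2] xk] := hx k kA.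
pose dl := `|x k - x j|.
have dl_gap : alpha / L%:R <= dl by rewrite /dl distrC gap.
have dl0 : 0 < dl by apply: lt_le_trans dl_gap; rewrite divr_gt0.
have dlL : dl <= L%:R^-1 by rewrite /dl ler_norml; apply/andP; split; lra.
have pi0 := @pi_gt0 R.
have QR : 0 < Q%:R :> R by rewrite ltr0n.
have lamR : 0 < lam%:R :> R by rewrite ltr0n.
have yb : 0 <= pi * Q%:R * dl <= pi / lam%:R.
  apply/andP; split; first by rewrite !mulr_ge0 ?ltW.
  rewrite -(mulrA pi) ler_pM2l//.
  rewrite -[leRHS]mul1r ler_pdivlMr// mulrAC; apply: (@le_trans _ _ (L%:R * dl)).
    by rewrite ler_pM2r.
  by rewrite mulrC -ler_pdivlMr// mul1r.
have sb := sin_sqr_ge l1 yb.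
have -> : normc (z j ^+ Q - z k ^+ Q) = 2 * `|sin (pi * Q%:R * dl)|.
  rewrite (z_sin xj xk) -mulrA /dl; case: (ger0P (x k - x j)) => _//.
  by rewrite !mulrN sinN normrN.
have p0 : 0 < (pi * Q%:R * dl) ^+ 2 * s2 by rewrite mulr_gt0// exprn_gt0// !mulr_gt0.
have sn0 : 0 < sin (pi * Q%:R * dl) ^+ 2 by apply: lt_le_trans sb.
split.
  have e2 (q : R) : (2 / (2 * q)) ^+ 2 = (q ^+ 2)^-1.
    by rewrite invfM mulVKf ?exprVn ?pnatr_eq0.
  rewrite e2 real_normK ?num_real//.
  have -> : 1 / ((pi * Q%:R) ^+ 2 * s2) * (1 / (x j - x k) ^+ 2) = ((pi * Q%:R * dl) ^+ 2 * s2)^-1.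
    rewrite !div1r -invfM; congr (_^-1).
    rewrite /dl [in RHS]exprMn real_normK ?num_real//.
    by rewrite -(sqrrN (x k - x j)) opprB mulrAC.
  by rewrite lef_pV2 ?posrE.
apply/negP => /eqP e; move: sn0.
have := z_sin xj xk; rewrite e subrr normc0 -mulrA => /esym/eqP.
rewrite mulf_eq0 pnatr_eq0/= normr_eq0 /dl => /eqP sn.
case: (ger0P (x k - x j)) => _; first by rewrite sn expr0n ltxx.
by rewrite mulrN mulrN sinN sqrrN sn expr0n ltxx.
Qed.

Lemma node_neq j k : j \in A -> k \in A -> k != j -> z k ^+ Q != z j ^+ Q.
Proof. by have [x _ h] := z_lower => jA kA kj; case: (h j k jA kA kj). Qed.

Let K_ge0 : (1 < lam)%N -> 0 <= 1 / ((pi * Q%:R) ^+ 2 * s2).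
Proof.
move=> l1; rewrite divr_ge0// mulr_ge0 ?sqr_ge0// ltW//.
exact: sinc_gt0.
Qed.

Let card_others j : j \in A -> #|[pred k | (k \in A) && (k != j)]| = lam.-1.
Proof.
by move=> jA; rewrite /lam (cardsD1 j A) jA; apply: eq_card => k; rewrite !inE andbC.
Qed.

(** A crude bound, to be set against the tiny kernel values at other clumps. In each factor alpha <=
    2 lam Q dl contributes 4, and 8 pi^2 s2 >= 1 contributes 8, whence 32. *)
Lemma lagrange_bound_le j : j \in A ->
  lagrange_bound A Q z j ^+ 2 <= (32 * lam%:R ^+ 2 / alpha ^+ 2) ^+ lam.-1.
Proof.
move=> jA; have [x gap h] := z_lower.
rewrite /lagrange_bound -prodrXl -(card_others jA) -prodr_const.
apply: ler_prod => k /andP[kA kj]; rewrite sqr_ge0/=.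
have l1 := lam_gt1 jA kA kj; have s2b := sinc_ge l1.
have [hk _] := h j k jA kA kj; apply: (le_trans hk).
have g := gap j k jA kA kj.
have QR : 0 < Q%:R :> R by rewrite ltr0n.
have lamR : 0 < lam%:R :> R by rewrite ltr0n.
have L2 : L%:R <= 2 * lam%:R * Q%:R :> R.
  by rewrite -!natrM ler_nat; exact: leq_double_divn.
set dl := `|x j - x k| in g *.
have dl2 : (x j - x k) ^+ 2 = dl ^+ 2 by rewrite real_normK ?num_real.
have g2 : alpha <= 2 * lam%:R * Q%:R * dl.
  move: g; rewrite ler_pdivrMr// => /le_trans; apply; rewrite mulrC ler_wpM2r//.
  exact: normr_ge0.
have g3 : alpha ^+ 2 <= 4 * (lam%:R * Q%:R * dl) ^+ 2.
  have -> : 4 * (lam%:R * Q%:R * dl) ^+ 2 = (2 * lam%:R * Q%:R * dl) ^+ 2 by ring.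
  by rewrite lerXn2r ?nnegrE ?(ltW alpha0)// (le_trans (ltW alpha0)).
have pi2 := @pi_ge2 R.
have ps : 1 <= 8 * (pi ^+ 2 * s2) :> R.
  have : 4 <= (pi : R) ^+ 2 by nra.
  by nra.
have s20 : 0 < s2 := sinc_gt0 l1.
have dl0 : 0 < dl by apply: lt_le_trans g; rewrite divr_gt0.
have lhs0 : 0 < (pi * Q%:R) ^+ 2 * s2 * dl ^+ 2.
  by rewrite !mulr_gt0// pi_gt0.
have rhs0 : 0 < 32 * lam%:R ^+ 2 / alpha ^+ 2.
  by rewrite divr_gt0 ?mulr_gt0 ?exprn_gt0.
rewrite !div1r -invfM dl2 -[leRHS]invrK lef_pV2 ?posrE ?invr_gt0//.
rewrite invf_div ler_pdivrMr ?mulr_gt0 ?exprn_gt0//.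
apply: (le_trans g3).
have -> : (pi * Q%:R) ^+ 2 * s2 * dl ^+ 2 * (32 * lam%:R ^+ 2) =
  (8 * (pi ^+ 2 * s2)) * (4 * (lam%:R * Q%:R * dl) ^+ 2) by ring.
by rewrite ler_peMl// mulr_ge0// sqr_ge0.
Qed.

(** 361/800 is the inverse square of the prefactor 20 sqrt 2 / 19 of [Bconst], and 1 / lam^2 cancels
    the factor lam of [Cconst]. What is left of the constant is exactly the value for equally spaced
    points. *)
Lemma sum_lagrange_bound_le :
  \sum_(j in A) lagrange_bound A Q z j ^+ 2 <=
  361 / (800 * lam%:R ^+ 2) * (Cconst R lam L * alpha ^- lam.-1) ^+ 2.
Proof.
have [x gap h] := z_lower.
have aL : 0 < alpha / L%:R by rewrite divr_gt0.
have := sum_prod_invr_spacing aL gap.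
set K := 1 / ((pi * Q%:R) ^+ 2 * s2).
rewrite -/lam; set Sg := \sum_(1 <= j < _) _ => hs.
apply: (@le_trans _ _ (K ^+ lam.-1 * ((alpha / L%:R) ^- 2 ^+ lam.-1 * Sg))).
  apply: (@le_trans _ _ (K ^+ lam.-1 * (\sum_(j in A) \prod_(k in A | k != j) (1 / (x j - x k) ^+ 2)))).
    rewrite mulr_sumr; apply: ler_sum => j jA.
    rewrite /lagrange_bound -prodrXl -(card_others jA) -prodr_const -big_split/=.
    apply: ler_prod => k /andP[kA kj]; rewrite sqr_ge0/=.
    by case: (h j k jA kA kj).
  have [l1|l1] := ltnP 1 lam.
    by rewrite ler_wpM2l// exprn_ge0// K_ge0.
  move: hs; have -> : lam.-1 = 0%N by apply/eqP; rewrite -subn1 subn_eq0.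
  by rewrite !expr0 !mul1r.
rewrite /Cconst /Bconst -/Q -/Sg.
have lamR : 0 < lam%:R :> R by rewrite ltr0n.
have QR : 0 < Q%:R :> R by rewrite ltr0n.
have Sg0 : 0 <= Sg.
  apply: sumr_ge0 => j _; apply: prodr_ge0 => k _.
  by rewrite divr_ge0// sqr_ge0.
have lam0 : (0 < lam)%N := A0.
have lamE : lam%:R - 1 = lam.-1%:R :> R by rewrite -{1}(prednK lam0) -natr1 addrK.
(* For lam = 1 the base [s2] is negative, but both exponents are 0. The final identity only asks
   that [s2] be nonzero. *)
have pw : (s2 `^ (- ((lam%:R - 1) / 2))) ^+ 2 = s2^-1 ^+ lam.-1.
  rewrite lamE; have [l1|l1] := ltnP 1 lam; last first.
    have -> : lam.-1 = 0%N by apply/eqP; rewrite -subn1 subn_eq0.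
    by rewrite mul0r oppr0 powRr0 expr1n.
  have s0 : 0 < s2 := sinc_gt0 l1.
  rewrite -powR_mulrn ?powR_ge0// -powRrM mulNr divfK ?pnatr_eq0//.
  by rewrite powRN powR_mulrn ?ltW// exprVn.
rewrite -/s2; move: pw; set w := s2 `^ _ => pw.
rewrite le_eqVlt; apply/orP; left; apply/eqP.
set n := lam.-1 in pw *.
have gen (l r b c e f g h' : R) : l != 0 ->
    361 / (800 * l ^+ 2) * (20 * r / 19 * b * c * e * l * f * h' * g) ^+ 2 =
    r ^+ 2 / 2 * (b ^+ 2 * c ^+ 2 * e ^+ 2 * f ^+ 2 * g ^+ 2) * h' ^+ 2.
  by move=> l0; field.
rewrite gen ?gt_eqF//.
rewrite !sqr_sqrtr// divff ?pnatr_eq0// mul1r pw mulrA; congr (_ * _).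
rewrite -![_ ^- n]exprVn -!exprM ![(n * 2)%N]mulnC !exprM -!exprMn.
congr (_ ^+ _); rewrite /K.
have s0 : s2 != 0.
  have [l1|l1] := ltnP 1 lam; first by rewrite gt_eqF// sinc_gt0.
  have l1' : lam = 1%N by apply/eqP; rewrite eqn_leq l1 lam0.
  have pi2 := @pi_ge2 R.
  by rewrite lt_eqF// /s2 l1' expr1n mulr1 subr_lt0 ltr_pdivlMr// mul1r; nra.
have pin : pi != 0 :> R by rewrite gt_eqF// pi_gt0.
have gen2 (p q u v l a : R) : [&& p != 0, q != 0, u != 0, v != 0, l != 0 & a != 0] ->
    1 / ((p * q) ^+ 2 * u) / (a / v) ^+ 2 =
    u^-1 * (v / l) ^+ 2 * q^-1 ^+ 2 * (l / p) ^+ 2 * a^-1 ^+ 2.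
  by move=> /and5P[p0 q0 u0 v0 /andP[l0 a0]]; field; rewrite p0 q0 u0 v0 l0 a0.
by apply: gen2; rewrite s0 pin !gt_eqF.
Qed.

End clump.

(** * The interpolating polynomial of one node *)

Section clump_polynomial.
Variable R : realType.
Local Notation C := R[i].

(** The distance of the two nodes is 2 |sin| >= 4 Y / L, so the geometric decay gives L / (2 (q+1)
    Y). *)
Lemma dirichlet_node_decay (q L : nat) (a b Y K : R) : (0 < L)%N -> 0 < Y ->
  Y / L%:R <= normT (a - b) -> 0 < K -> L%:R <= 2 * K * q.+1%:R ->
  normc (dirichlet q (node a)).[node b] <= K / Y.
Proof.
move=> L0 Y0 hY K0 hK; have LR : 0 < L%:R :> R by rewrite ltr0n.
have := dirichlet_decay q (normc_node a) (normc_node b).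
have -> : node b - node a = node b ^+ 1 - node a ^+ 1 by rewrite !expr1.
rewrite normc_nodeB mul1r; have h := normT_sin (a - b).
set D := normc _; have D0 : 0 <= D by exact: normc_ge0.
rewrite ler_pdivlMr//; move: hY; rewrite ler_pdivrMr// => hY hD.
have : 0 < q.+1%:R :> R by rewrite ltr0n.
move: hK hD; move: (q.+1%:R : R) => x hK hD x0.
have h1 : D * (x * (4 * normT (a - b))) <= 2.
  apply: le_trans hD; rewrite ler_wpM2l// (ler_wpM2l (ltW x0))//; lra.
have h2 : D * (x * (4 * Y)) <= 2 * L%:R.
  apply: (@le_trans _ _ (D * (x * (4 * normT (a - b))) * L%:R)); last by rewrite ler_pM2r.
  rewrite -!mulrA ler_wpM2l// ler_pM2l// ler_pM2l//.
have h3 : D * (x * (4 * Y)) <= 4 * K * x 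
  by apply: (le_trans h2); rewrite (_ : 4 * K * x = 2 * (2 * K * x)) ?ler_pM2l//; ring.
rewrite -(@ler_pM2l _ (4 * x)) ?mulr_gt0//.
have -> : 4 * x * (D * Y) = D * (x * (4 * Y)) by ring.
by rewrite mulrAC.
Qed.

Lemma size_mul_budget (a b c e n L : nat) : (a <= (c + e).+1)%N ->
  (n + c = L)%N -> (e <= n)%N -> (b <= (n - e).+1)%N -> ((a + b).-1 <= L.+1)%N.
Proof. by lia. Qed.

(* [f] is [lagrange * D_q1 ^ (2 lam) * D_q0] with [2 lam q1] about a fifth and
   [q0] about four fifths of the degree left by the Lagrange factor. *)
Lemma clump_poly (S L : nat) (omega : 'I_S -> R) (A : {set 'I_S}) (j : 'I_S)
    (Q := (L %/ #|A|)%N) (z := fun k => node (omega k))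
    (B := lagrange_bound A Q z j) (lam := #|A|) :
  j \in A -> (#|A| <= L)%N ->
  (forall k, k \in A -> k != j -> z k ^+ Q != z j ^+ Q) ->
  exists f : {poly C}, [/\ (size f <= L.+1)%N, f.[z j] = 1,
    forall k, k \in A -> k != j -> f.[z k] = 0,
    \sum_(i < L.+1) normc f`_i ^+ 2 <= B ^+ 2 * (5 * lam%:R / (4 * L%:R)) &
    forall b Y, 0 < Y -> Y / L%:R <= normT (omega j - b) ->
      normc f.[node b] <= B * (5 * lam%:R ^+ 2 / Y) ^+ (2 * lam) /\
      normc f.[node b] <= B * (5 * lam%:R ^+ 2 / Y) ^+ (2 * lam) * (5 * lam%:R / 8 / Y)].
Proof.
move=> jA AL zneq.
have lam0 : (0 < lam)%N by rewrite /lam (cardD1 j) jA.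
have L0 : (0 < L)%N by exact: leq_trans lam0 AL.
(* The degree left by the Lagrange factor. That factor takes at most the fraction (lam - 1) / lam of
   L, hence [nL]. *)
pose n := (L - Q * lam.-1)%N.
have QL : (Q * lam <= L)%N by exact: leq_trunc_div.
have Ql : (Q * lam.-1 <= L)%N by apply: leq_trans QL; rewrite leq_mul2l leq_pred orbT.
have nL : (L <= n * lam)%N.
  rewrite /n mulnBl leq_subRL; last by rewrite leq_mul2r Ql orbT.
  rewrite -mulnA (mulnC lam.-1) mulnA.
  apply: (@leq_trans (L * lam.-1 + L)%N); first by rewrite leq_add2r leq_mul2r QL orbT.
  by rewrite -mulnSr prednK.
pose q1 := (n %/ (10 * lam))%N; pose q0 := (n - 2 * lam * q1)%N.
have q1n : (q1 * (10 * lam) <= n)%N by exact: leq_trunc_div.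
have q1L : (L <= 10 * lam ^ 2 * q1.+1)%N.
  apply: (leq_trans nL); have : (n <= q1.+1 * (10 * lam))%N.
    by apply/ltnW/ltn_ceil; rewrite muln_gt0.
  move=> h; apply: (@leq_trans (q1.+1 * (10 * lam) * lam)%N); first by rewrite leq_mul2r h orbT.
  by rewrite leq_eqVlt; apply/orP; left; apply/eqP; ring.
have q0n : (4 * n <= 5 * q0)%N.
  rewrite /q0 mulnBr leq_subRL; first by nia.
  by nia.
have q0L : (4 * L <= 5 * lam * q0.+1)%N.
  apply: (@leq_trans (4 * (n * lam))%N); first by rewrite leq_mul2l nL.
  rewrite mulnA [leqRHS]mulnAC leq_mul2r; apply/orP; right.
  by apply: (leq_trans q0n); rewrite leq_mul2l leqnSn orbT.
pose g := lagrange A Q z j * dirichlet q1 (z j) ^+ (2 * lam).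
have z1 k : normc (z k) = 1 by exact: normc_node.
have zj0 : z j != 0 by exact: expi_neq0.
have szg : (size g <= (Q * lam.-1 + q1 * (2 * lam)).+1)%N.
  apply: leq_trans (size_polyMleq _ _) _.
  have h1 := size_lagrange Q z jA.
  have h2 : (size (dirichlet q1 (z j) ^+ (2 * lam))%R <= (q1 * (2 * lam)).+1)%N.
    apply: leq_trans (size_exp_leq _ _) _; rewrite ltnS leq_mul2r; apply/orP; right.
    by have := size_dirichlet q1 (z j); case: (size _).
  move: h1 h2; rewrite -/lam; move: (size _) (size _) (Q * lam.-1)%N (q1 * (2 * lam))%N => a b c e.
  by clear; lia.
have szf : (size (g * dirichlet q0 (z j))%R <= L.+1)%N.
  apply: leq_trans (size_polyMleq _ _) _.
  have := size_dirichlet q0 (z j).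
  have : (2 * lam * q1 <= n)%N.
    by apply: leq_trans q1n; rewrite mulnC leq_mul2l leq_mul2r orbT orbT.
  have : (n + Q * lam.-1 = L)%N by rewrite /n subnK.
  by move: szg; rewrite /q0 (mulnC q1); exact: size_mul_budget.
have B0 : 0 <= B by exact: lagrange_bound_ge0.
have gB w : normc w = 1 -> normc g.[w] <= B.
  move=> w1; rewrite hornerM normcM -[leRHS]mulr1 ler_pM ?normc_ge0//.
    exact: lagrange_le.
  rewrite horner_exp normcX exprn_ile1 ?normc_ge0//.
  exact: dirichlet_le1.
have LR : 0 < L%:R :> R by rewrite ltr0n.
have lamR : 0 < lam%:R :> R by rewrite ltr0n.
exists (g * dirichlet q0 (z j)); split => //.
- rewrite !hornerM horner_exp !dirichlet_center// expr1n !mulr1.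
  exact: lagrange_center.
- by move=> k kA kj; rewrite !hornerM lagrange_other// !mul0r.
- have qL : (q0 < L.+1)%N by rewrite ltnS /q0 /n -subnDA leq_subr.
  apply: le_trans (coef_norm_mul_dirichlet (z1 j) qL szf B0 gB) _.
  rewrite ler_wpM2l ?sqr_ge0// -[leRHS]invrK lef_pV2 ?posrE ?ltr0n ?invr_gt0 ?divr_gt0 ?mulr_gt0//.
  rewrite invf_div ler_pdivrMr ?mulr_gt0// -!natrM ler_nat.
  by rewrite (mulnC q0.+1).
move=> b Y Y0 hY.
have D1 : normc (dirichlet q1 (z j)).[node b] <= 5 * lam%:R ^+ 2 / Y.
  apply: dirichlet_node_decay hY _ _ => //; first by rewrite mulr_gt0// exprn_gt0.
  by rewrite mulrA -natrX -!natrM ler_nat.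
have D0 : normc (dirichlet q0 (z j)).[node b] <= 5 * lam%:R / 8 / Y.
  apply: dirichlet_node_decay hY _ _ => //; first by rewrite divr_gt0 ?mulr_gt0.
  have : (4 * L)%:R <= (5 * lam * q0.+1)%:R :> R by rewrite ler_nat.
  by rewrite !natrM; lra.
have gY : normc g.[node b] <= B * (5 * lam%:R ^+ 2 / Y) ^+ (2 * lam).
  rewrite hornerM normcM ler_pM ?normc_ge0//.
    by apply: lagrange_le => //; exact: normc_node.
  rewrite horner_exp normcX lerXn2r ?nnegrE ?normc_ge0//.
  by rewrite divr_ge0 ?mulr_ge0 ?ltW// exprn_gt0.
(* The second estimate keeps the decay of the long kernel, used for lam = 1; the first bounds that
   kernel by 1. *)
rewrite hornerM normcM; split; last by rewrite ler_pM ?normc_ge0.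
rewrite -[leRHS]mulr1 ler_pM ?normc_ge0// dirichlet_le1//.
exact: normc_node.
Qed.

End clump_polynomial.

(* For [lam = 1] one uses [Y ^ 3 >= alpha beta ^ 2]; for [lam > 1], where
   [alpha <= 1], the power [Y ^ (4 lam)] absorbs [alpha ^ (- 2 (lam - 1))]. *)
Lemma cross_clump_bound (R : realType) (S lam : nat) (alpha beta Y B v : R) :
  (0 < S)%N -> (0 < lam)%N -> 0 < alpha -> 0 < beta -> alpha <= Y -> beta <= Y ->
  400 * S%:R * lam%:R ^+ 5 <= alpha * beta ^+ 2 ->
  ((1 < lam)%N -> alpha <= 1) ->
  0 <= B -> B ^+ 2 <= (32 * lam%:R ^+ 2 / alpha ^+ 2) ^+ lam.-1 -> 0 <= v ->
  v <= B * (5 * lam%:R ^+ 2 / Y) ^+ (2 * lam) ->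
  v <= B * (5 * lam%:R ^+ 2 / Y) ^+ (2 * lam) * (5 * lam%:R / 8 / Y) ->
  v <= 5 / 128 / S%:R.
Proof.
move=> S0 l0 a0 b0 aY bY hb ha B0 hB v0 v1 v2.
have SR : 0 < S%:R :> R by rewrite ltr0n.
have lR : 0 < lam%:R :> R by rewrite ltr0n.
have Y0 : 0 < Y by apply: lt_le_trans aY.
have b2 : beta ^+ 2 <= Y ^+ 2 by rewrite lerXn2r ?nnegrE ?(ltW b0) ?(ltW Y0).
have [l1|l1] := ltnP 1 lam; last first.
  have lE : lam = 1%N by apply/eqP; rewrite eqn_leq l1 l0.
  move: hb hB v2; rewrite lE !expr1n !mulr1 muln1 => hb hB v2.
  have B1 : B <= 1 by rewrite -(@ler_pXn2r _ 2)// ?nnegrE// expr1n.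
  have Y3 : 400 * S%:R <= Y ^+ 3.
    apply: (le_trans hb); have -> : Y ^+ 3 = Y * Y ^+ 2 by rewrite exprS.
    by rewrite ler_pM ?(ltW a0) ?sqr_ge0.
  apply: (le_trans v2).
  apply: (@le_trans _ _ (1 * (5 / Y) ^+ 2 * (5 / 8 / Y))).
    have q0 : 0 <= 5 / 8 / Y by rewrite divr_ge0 ?divr_ge0 ?ltW.
    by rewrite (ler_wpM2r q0)// ler_wpM2r// sqr_ge0.
  have -> : 1 * (5 / Y) ^+ 2 * (5 / 8 / Y) = 125 / 8 / Y ^+ 3.
    by field; rewrite gt_eqF.
  rewrite ler_pdivrMr ?exprn_gt0//.
  (* 125/8 divided by 400 S is 5/128 / S: the case lam = 1 fixes the constant 5/128. *)
  apply: (@le_trans _ _ (5 / 128 / S%:R * (400 * S%:R))); last first.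
    by rewrite ler_wpM2l// divr_ge0.
  have -> : 5 / 128 / S%:R * (400 * S%:R) = 5 / 128 * 400 :> R by field; rewrite gt_eqF.
  lra.
have a1 := ha l1.
(* The quotient of 25 lam^4 by 400 S lam^5 / alpha. Of the 2 lam factors [g] bounding the square of
   the short kernel power, all but two pair with those of B^2: each 32 lam^2 g^2 / alpha^2 equals 1
   / (8 S^2). *)
pose g := alpha / (16 * S%:R * lam%:R).
have g0 : 0 < g by rewrite divr_gt0 ?mulr_gt0.
have ug : (5 * lam%:R ^+ 2 / Y) ^+ 2 <= g.
  rewrite /g expr_div_n ler_pdivrMr ?exprn_gt0// mulrAC ler_pdivlMr ?mulr_gt0//.
  apply: (@le_trans _ _ (alpha * beta ^+ 2)); last first.
    by rewrite ler_pM2l.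
  by apply: le_trans hb; rewrite le_eqVlt; apply/orP; left; apply/eqP; ring.
have vv : v ^+ 2 <= g ^+ 2.
  apply: (@le_trans _ _ ((B * (5 * lam%:R ^+ 2 / Y) ^+ (2 * lam)) ^+ 2)).
    by rewrite lerXn2r ?nnegrE// (le_trans v0).
  set u := 5 * _ / Y in ug *; rewrite exprMn.
  have -> : (u ^+ (2 * lam)) ^+ 2 = ((u ^+ 2) ^+ 2) ^+ lam.
    by rewrite -exprM mulnAC exprM exprM.
  have uu : (u ^+ 2) ^+ 2 <= (g ^+ 2).
    by rewrite lerXn2r ?nnegrE ?sqr_ge0 ?(ltW g0).
  have uul : ((u ^+ 2) ^+ 2) ^+ lam <= (g ^+ 2) ^+ lam.
    by rewrite lerXn2r ?nnegrE ?sqr_ge0.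
  apply: (@le_trans _ _ ((32 * lam%:R ^+ 2 / alpha ^+ 2) ^+ lam.-1 * (g ^+ 2) ^+ lam)).
    by rewrite ler_pM ?sqr_ge0 ?(exprn_ge0 _ (sqr_ge0 _)).
  have -> : (g ^+ 2) ^+ lam = g ^+ 2 * (g ^+ 2) ^+ lam.-1 by rewrite -exprS prednK.
  rewrite mulrCA -exprMn.
  have -> : 32 * lam%:R ^+ 2 / alpha ^+ 2 * g ^+ 2 = (8 * S%:R ^+ 2)^-1.
    by rewrite /g; field; rewrite !gt_eqF.
  have S2 : 1 <= S%:R ^+ 2 :> R by rewrite exprn_ege1// ler1n.
  rewrite ger_pMr ?exprn_gt0// exprn_ile1 ?invr_ge0 ?invf_le1//; lra.
have {}vv : v <= g by move: vv; rewrite ler_pXn2r// ?nnegrE// ltW.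
apply: (le_trans vv); rewrite /g ler_pdivrMr ?mulr_gt0//.
have -> : 5 / 128 / S%:R * (16 * S%:R * lam%:R) = 5 / 8 * lam%:R :> R.
  by field; rewrite gt_eqF.
have l2 : 2 <= lam%:R :> R by rewrite ler_nat.
by move: l2; move: (lam%:R : R) => l; lra.
Qed.

(** * Smallest singular value of the Fourier matrix *)

Section sigma_min.
Variable R : realType.
Local Notation C := R[i].

Lemma Fourier_mx_lower_bound (A S L : nat) (alpha beta : R) (omega : 'I_S -> R)
    (Lambda : 'I_A -> {set 'I_S}) :
  (0 < S)%N -> (S <= L)%N -> 0 < alpha -> 0 < beta ->
  clumps_model L beta alpha omega Lambda ->
  (forall a : 'I_A,
    20 * Num.sqrt S%:R * (#|Lambda a|%:R `^ (5 / 2)) / Num.sqrt alpha <= beta) ->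
  forall c : 'cV[C]_S,
  817 / 500 * L%:R * norm2 c ^+ 2 <=
  norm2 (Fourier_mx L omega *m c) ^+ 2 *
  \sum_(a < A) (Cconst R #|Lambda a| L * alpha ^- #|Lambda a|.-1) ^+ 2.
Proof.
move=> S0 SL a0 b0 cm hsep c.
have L0 : (0 < L)%N by exact: leq_trans SL.
have LR : 0 < L%:R :> R by rewrite ltr0n.
have [cl hcl] := choice (cm_cover cm).
pose z k := node (omega k).
have cardL a : (#|Lambda a| <= L)%N.
  by apply: leq_trans SL; rewrite -[leqRHS]card_ord max_card.
have sep a j k : j \in Lambda a -> k \in Lambda a -> k != j ->
    alpha / L%:R <= normT (omega j - omega k).
  by move=> _ _ kj; apply: (cm_point_sep cm); rewrite eq_sym.
have alpha1 a : (1 < #|Lambda a|)%N -> alpha <= 1.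
  move=> l1; have := cm_clump_card cm a.
  have : 1 <= (#|Lambda a|.-1)%:R :> R by rewrite ler1n; case: #|_| l1 => [|[]].
  by move=> /le_lt_trans /[apply] /ltW; rewrite invf_ge1.
(* The separation hypothesis squared, to remove the roots. *)
have hsep2 a : 400 * S%:R * #|Lambda a|%:R ^+ 5 <= alpha * beta ^+ 2.
  have h := hsep a; set l : R := #|Lambda a|%:R in h *.
  have p5 : (l `^ (5 / 2)) ^+ 2 = l ^+ 5.
    by rewrite -powR_mulrn ?powR_ge0// -powRrM divfK ?pnatr_eq0// powR_mulrn.
  have : (20 * Num.sqrt S%:R * l `^ (5 / 2) / Num.sqrt alpha) ^+ 2 <= beta ^+ 2.
    rewrite ler_pXn2r// ?nnegrE ?(ltW b0)//.
    by rewrite divr_ge0 ?mulr_ge0 ?sqrtr_ge0 ?powR_ge0.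
  rewrite expr_div_n !exprMn p5 !sqr_sqrtr ?ler0n ?(ltW a0)//.
  rewrite ler_pdivrMr// [leRHS]mulrC; apply: le_trans.
  by rewrite le_eqVlt; apply/orP; left; apply/eqP; ring.
pose B j := lagrange_bound (Lambda (cl j)) (L %/ #|Lambda (cl j)|)%N z j.
pose F j := B j ^+ 2 * (5 * #|Lambda (cl j)|%:R / (4 * L%:R)).
have polys j : exists f : {poly C}, [/\ (size f <= L.+1)%N, f.[z j] = 1,
    \sum_(i < L.+1) normc f`_i ^+ 2 <= F j &
    forall k, k != j -> normc f.[z k] <= 5 / 128 / S%:R].
  have [t ht] := cm_arc cm (cl j).
  have lam0 := cm_nonempty cm (cl j).
  have sepj := sep (cl j).
  have zneq k : k \in Lambda (cl j) -> k != j ->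
      z k ^+ (L %/ #|Lambda (cl j)|) != z j ^+ (L %/ #|Lambda (cl j)|).
    by move=> kA kj; apply: (node_neq a0 (@sepj) ht lam0 (cardL _)).
  have [f [sz fj f0 fn ffar]] := clump_poly (hcl j) (cardL _) zneq.
  exists f; split => // k kj.
  have [kA|kA] := boolP (k \in Lambda (cl j)).
    by rewrite f0// normc0 divr_ge0.
  pose Y := L%:R * normT (omega j - omega k).
  have aY : alpha <= Y.
    by rewrite /Y mulrC -ler_pdivrMr// (cm_point_sep cm)// eq_sym.
  have bY : beta <= Y.
    have ab : cl j != cl k by apply: contraNneq kA => ->; exact: hcl.
    rewrite /Y mulrC -ler_pdivrMr// (cm_clump_sep cm _ ab)//.
    by move: (cl j) (cl k) ab; case: (A) => [|[|//]] [[|//] ?] [[|//] ?].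
  have Y0 : 0 < Y by exact: lt_le_trans aY.
  have [] := ffar (omega k) Y Y0.
    by rewrite /Y mulrAC mulfV ?mul1r// gt_eqF.
  apply: cross_clump_bound aY bY _ _ _ _ _ => //.
  - exact: alpha1.
  - exact: lagrange_bound_ge0.
  - exact: (lagrange_bound_le a0 (@sepj) ht lam0 (cardL _)).
  - exact: normc_ge0.
have [f hf] := choice polys.
have th : 0 <= (5 / 128 : R) <= 1 by apply/andP; split; lra.
have hPhi m j : Fourier_mx L omega m j = z j ^+ m.
  by rewrite mxE /z /node expiX; congr expi; ring.
have h : (1 - 5 / 128) ^+ 2 * norm2 c ^+ 2 <=
    norm2 (Fourier_mx L omega *m c) ^+ 2 * \sum_j F j.
  apply: (dual_lower_bound hPhi th (f := f)) => j; case: (hf j) => //.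
have sumF : \sum_j F j <= 361 / 640 / L%:R *
    \sum_(a < A) (Cconst R #|Lambda a| L * alpha ^- #|Lambda a|.-1) ^+ 2.
  rewrite (partition_big cl xpredT)//= mulr_sumr; apply: ler_sum => a _.
  have [t ht] := cm_arc cm a; have lam0 := cm_nonempty cm a.
  have sb := sum_lagrange_bound_le a0 (@sep a) ht lam0 (cardL a).
  set X := (_ * _) ^+ 2 in sb *; have X0 : 0 <= X by exact: sqr_ge0.
  have -> : \sum_(j | cl j == a) F j =
     (\sum_(j in Lambda a) lagrange_bound (Lambda a) (L %/ #|Lambda a|)%N z j ^+ 2)
       * (5 * #|Lambda a|%:R / (4 * L%:R)).
    rewrite mulr_suml; apply: eq_big => j; last by move=> /eqP ja; rewrite /F /B ja.
    apply/eqP/idP => [<-|ja]; first exact: hcl.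
    exact: (cm_disjoint cm (hcl j) ja).
  have l1 : 1 <= #|Lambda a|%:R :> R by rewrite ler1n.
  apply: (@le_trans _ _ (361 / (800 * #|Lambda a|%:R ^+ 2) * X * (5 * #|Lambda a|%:R / (4 * L%:R)))).
    by rewrite ler_wpM2r// divr_ge0 ?mulr_ge0 ?ler0n ?(ltW LR).
  move: sb l1; move: (#|Lambda a|%:R : R) => l _ l1.
  have l0 : 0 < l by lra.
  have -> : 361 / (800 * l ^+ 2) * X * (5 * l / (4 * L%:R)) = 361 / 640 / L%:R * X * l^-1.
    by field; rewrite !gt_eqF.
  have q0 : 0 <= 361 / 640 / L%:R :> R by rewrite divr_ge0 ?divr_ge0 ?ler0n.
  (* One spare factor 1 / lam is given up, to make the constant uniform over clumps. *)
  have li : l^-1 <= 1 by rewrite invf_le1.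
  exact: ler_piMr (mulr_ge0 q0 X0) li.
set Cs := \sum_(a < A) _ in sumF *.
set N := norm2 (_ *m _) ^+ 2 in h *.
have N0 : 0 <= N by exact: sqr_ge0.
have h2 : (1 - 5 / 128) ^+ 2 * norm2 c ^+ 2 <= N * (361 / 640 / L%:R * Cs).
  by apply: (le_trans h); rewrite ler_wpM2l.
have h3 : (1 - 5 / 128) ^+ 2 * norm2 c ^+ 2 * L%:R <= 361 / 640 * (N * Cs).
  rewrite -ler_pdivlMr//; apply: (le_trans h2).
  by rewrite le_eqVlt; apply/orP; left; apply/eqP; field; rewrite gt_eqF.
have c0 : 0 <= L%:R * norm2 c ^+ 2 by rewrite mulr_ge0 ?sqr_ge0 ?ltW.
(* 817/500 is a rational just below (1 - 5/128)^2 * 640 / 361. *)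
rewrite -mulrA; move: h3 c0; rewrite -mulrA (mulrC (norm2 c ^+ 2)).
move: (L%:R * _) (N * Cs) => p q; lra.
Qed.

End sigma_min.

(** * Numerical union bound, Hankel factorization and conclusion *)

Lemma union_bound_numeric (R : realType) (n : nat) (nu : R) : (3 <= n)%N -> 1 < nu ->
  n%:R * (2 * expR (- (4 / 3 * (nu * n.+1%:R * ln n.+1%:R) / n%:R))) <=
  n.+1%:R `^ (- (nu - 1)).
Proof.
move=> n3 nu1.
have n0 : 0 < n%:R :> R by rewrite ltr0n (leq_trans _ n3).
have nN : n.+1%:R = n%:R + 1 :> R by rewrite -natr1.
have N0 : 0 < n.+1%:R :> R by rewrite ltr0n.
have l2 : 0 < ln 2 :> R by rewrite ln_gt0// ltr1n.
set l : R := ln n.+1%:R.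
have hl k : (2 ^ k <= n.+1)%N -> k%:R * ln 2 <= l.
  by move=> h; rewrite mulr_natl -lnXn// ler_ln ?posrE ?exprn_gt0// -natrX ler_nat.
have l0 : 0 < l by rewrite ln_gt0// ltr1n ltnS (leq_trans _ n3).
(* The case nu = 1, with ln n bounded by l. For n >= 7, l >= 3 ln 2 suffices; below that l >= 2 ln 2
   needs help from 4 / (3 n) >= 2/9. *)
have key : ln 2 <= l * (1 / 3 + 4 / 3 / n%:R).
  have [n7|n7] := leqP 7 n.
    have := hl 3%N n7; have : 0 <= 4 / 3 / n%:R * l by rewrite mulr_ge0 ?divr_ge0 ?ltW.
    by lra.
  have := hl 2%N n3 => h.
  have : 2 / 9 <= 4 / 3 / n%:R :> R.
    rewrite ler_pdivlMr//; have : n%:R <= 6 :> R by rewrite (ler_nat R n 6).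
    by lra.
  by nra.
have -> : n%:R * (2 * expR (- (4 / 3 * (nu * n.+1%:R * l) / n%:R))) =
   expR (ln n%:R + ln 2 - 4 / 3 * (nu * n.+1%:R * l) / n%:R).
  by rewrite !expRD !lnK ?posrE// mulrA.
rewrite /powR gt_eqF// -/l ler_expR.
have -> : 4 / 3 * (nu * n.+1%:R * l) / n%:R = nu * (l * (4 / 3 + 4 / 3 / n%:R)).
  by rewrite nN; field; rewrite gt_eqF.
have ln_n : ln n%:R <= l by rewrite ler_ln ?posrE// ler_nat.
have q0 : 0 <= l * (4 / 3 / n%:R) by rewrite mulr_ge0 ?divr_ge0 ?ltW.
(* Reduces to nu = 1, the coefficient of nu being nonnegative. *)
have : l * (4 / 3 + 4 / 3 / n%:R) - l <= nu * (l * (4 / 3 + 4 / 3 / n%:R) - l).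
  by rewrite ler_peMl ?ltW//; nra.
move: key q0; rewrite !mulrDr; lra.
Qed.

Section model.
Variable R : realType.
Local Notation C := R[i].

(** diag(x) times a transposed Fourier matrix: the right factor in the Vandermonde factorization of
    the noiseless Hankel matrix. *)
Definition right_factor (S n : nat) (omega : 'I_S -> R) (x : 'cV[C]_S) : 'M[C]_(S, n.+1) :=
  \matrix_(j, q) (x j 0 * node (omega j) ^+ q).

Lemma Hankel_factor (S M L : nat) (omega : 'I_S -> R) (x : 'cV[C]_S) : (L <= M)%N ->
  Hankel L (Fourier_mx M omega *m x) = Fourier_mx L omega *m right_factor (M - L) omega x.
Proof.
move=> LM; apply/matrixP => p q; rewrite !mxE; apply: eq_bigr => j _.
rewrite !mxE /node expiX inordK; last first.
  by have := ltn_ord p; have := ltn_ord q; lia.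
rewrite mulrCA mulrC -expiD; congr (_ * expi _).
by rewrite natrD; ring.
Qed.

(** Up to entrywise conjugation, the adjoint of the right factor maps [d] to the Fourier image of
    the vector with entries x_j conj(d_j), whose norm is at least xmin |d|. *)
Lemma right_factor_lower_bound (S n : nat) (omega : 'I_S -> R) (x : 'cV[C]_S) (mu xmin : R) :
  0 <= mu -> (forall j, xmin <= normc (x j 0)) -> 0 <= xmin ->
  (forall c, mu * norm2 c <= norm2 (Fourier_mx n omega *m c)) ->
  forall d, mu * xmin * norm2 d <= norm2 ((right_factor n omega x) ^t* *m d).
Proof.
move=> mu0 xm xm0 h d; pose c := \col_j (x j 0 * (d j 0)^*).
have -> : norm2 ((right_factor n omega x) ^t* *m d) = norm2 (Fourier_mx n omega *m c).
  rewrite /norm2; congr Num.sqrt; apply: eq_bigr => q _; congr (_ ^+ 2).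
  rewrite -normc_conj; congr normc; rewrite !mxE rmorph_sum/=.
  apply: eq_bigr => j _; rewrite !mxE; rewrite (conjC_mulC _ (d j 0)) conjCK /node expiX.
  by rewrite mulrAC mulrC; congr (expi _ * _); ring.
apply: le_trans (h c); rewrite -mulrA ler_wpM2l//.
rewrite -(@ler_pXn2r _ 2)// ?nnegrE ?mulr_ge0 ?norm2_ge0//.
rewrite exprMn !norm2_sqr mulr_sumr; apply: ler_sum => j _.
rewrite mxE normcM normc_conj exprMn ler_wpM2r ?sqr_ge0//.
by rewrite lerXn2r ?nnegrE ?normc_ge0.
Qed.

Lemma noise_corr_dist (L k k' : nat) (W : 'M[C]_(L.+1, k)) (W' : 'M[C]_(L.+1, k')) (w eps : R) :
  0 <= eps ->
  (forall v, `|norm2 (W ^t* *m v) - norm2 (W' ^t* *m v)| <= eps * norm2 v) ->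
  `|noise_corr W w - noise_corr W' w| <= eps.
Proof.
move=> e0 h; rewrite /noise_corr -mulrBl normrM normfV.
have := norm2_ge0 (steering L w); rewrite le_eqVlt => /predU1P[<-|n0].
  by rewrite normr0 invr0 mulr0.
by rewrite (ger0_norm (ltW n0)) ler_pdivrMr.
Qed.

End model.

Theorem corollary4p7 (R : realType) (A M S L : nat)
  (hA : (0 < A)%N) (hM0 : (0 < M)%N) (hS : (0 < S)%N)
  (hMS : (S ^ 2 <= M)%N) (hM : ~~ odd M) (hL : L = M./2)
  (alpha beta : R) (halpha : 0 < alpha) (hbeta : 0 < beta)
  (omega : 'I_S -> R) (Lambda : 'I_A -> {set 'I_S})
  (hOmega : clumps_model L beta alpha omega Lambda)
  (hsep : forall a : 'I_A,
     20 * Num.sqrt S%:R * (#|Lambda a|%:R `^ (5 / 2)) / Num.sqrt alpha <= beta)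
  (x : 'cV[R[i]]_S) (xmin : R)
  (hxmin : xmin = inf (range (fun j : 'I_S => normc (x j 0))))
  (hxmin0 : 0 < xmin)
  (sigma : R) (hsigma : 0 < sigma)
  (d : measure_display) (T : measurableType d) (P : probability T R)
  (eta : 'I_M.+1 -> {RV P >-> R}) (heta : gaussian_vector sigma eta)
  (y0 : 'cV[R[i]]_M.+1) (hy0 : y0 = Fourier_mx M omega *m x)
  (y : T -> 'cV[R[i]]_M.+1)
  (hy : forall t, y t = y0 + \col_m ((eta m t)%:C)%C)
  (k : nat) (W : 'M[R[i]]_(L.+1, k))
  (hW : orthobasis_range_perp (Hankel L y0) W)
  (What : T -> 'M[R[i]]_(L.+1, L.+1 - S))
  (hWhat : forall t, svd_noise_space (Hankel L (y t)) (What t))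
  (eps nu : R) (heps : 0 < eps) (hnu : 1 < nu)
  (hsnr : sigma / xmin <
     M%:R / (4 * Num.sqrt (nu * (M + 2)%:R * ln (M + 2)%:R))
     * (\sum_(a < A)
          (Cconst R #|Lambda a| L * alpha ^- #|Lambda a|.-1) ^+ 2)^-1
     * eps) :
  prob_at_least P (1 - (M + 2)%:R `^ (- (nu - 1)))
    [set t : T |
      (ereal_sup [set (`|noise_corr (What t) w - noise_corr W w|)%:E
                 | w in `[0%R, 1%R[ ] <= eps%:E)%E].
Proof.
have hM2 : M = L.*2 by rewrite hL -[LHS]odd_double_half (negbTE hM).
clear hL hM; subst M.
have L0 : (0 < L)%N by rewrite -double_gt0.
have SL : (S <= L)%N.
  have [S1|S2] := leqP S 1; first exact: leq_trans S1 L0.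
  rewrite -leq_double (leq_trans _ hMS)// -mul2n -mulnn leq_mul2r S2 orbT//.
have LL : (L <= L.*2)%N by rewrite -addnn leq_addr.
have LR : 0 < L%:R :> R by rewrite ltr0n.
set Cs := \sum_(a < A) _ in hsnr.
have low c := Fourier_mx_lower_bound hS SL halpha hbeta hOmega hsep c.
rewrite -/Cs in low.
have K0 : 0 < 817 / 500 :> R by lra.
have K2 : 8 / 3 <= (817 / 500) ^+ 2 :> R by lra.
(* From here on only K > 0 and K^2 >= 8/3 matter. *)
move: (817 / 500 : R) K0 K2 low => K K0 K2 low.
have Cs0 : 0 < Cs.
  (* If [Cs] were 0, [low] would fail at the vector of ones. *)
  rewrite lt_def sumr_ge0 ?andbT; last by move=> a _; exact: sqr_ge0.
  apply/negP => /eqP Cz; have := low (const_mx 1); rewrite Cz mulr0.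
  have : 0 < norm2 (const_mx 1 : 'cV[R[i]]_S).
    apply: norm2_gt0; apply/negP => /eqP/matrixP/(_ (Ordinal hS) 0).
    by rewrite !mxE => /eqP; rewrite oner_eq0.
  by move=> n0; apply/negP; rewrite -ltNge !mulr_gt0// exprn_gt0.
pose kap := K * L%:R / Cs.
have kap0 : 0 < kap by rewrite divr_gt0 ?mulr_gt0.
have hPhi c : Num.sqrt kap * norm2 c <= norm2 (Fourier_mx L omega *m c).
  rewrite -(@ler_pXn2r _ 2)// ?nnegrE ?mulr_ge0 ?sqrtr_ge0 ?norm2_ge0//.
  rewrite exprMn (sqr_sqrtr (ltW kap0)) /kap mulrAC ler_pdivrMr//.
have hx j : xmin <= normc (x j 0).
  rewrite hxmin; apply: ge_inf; last by exists j.
  by exists 0 => _ [i _ <-]; exact: normc_ge0.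
(* As M = 2L, both Hankel factors obey the same bound. The free [n] avoids rewriting L.*2 - L inside
   matrix types. *)
have hG n : n = L -> forall d, Num.sqrt kap * xmin * norm2 d <=
    norm2 ((right_factor n omega x) ^t* *m d).
  move=> ->; apply: right_factor_lower_bound => //.
  exact: ltW.
have sk0 : 0 < Num.sqrt kap by rewrite sqrtr_gt0.
have nL : (L.*2 - L)%N = L by rewrite -addnn addnK.
pose tau := Num.sqrt kap * (Num.sqrt kap * xmin).
have tauE : tau = kap * xmin by rewrite /tau mulrA -expr2 sqr_sqrtr// ltW.
have tau0 : 0 < tau by rewrite tauE mulr_gt0.
(* Makes the perturbation bound 2 t0 / tau equal to [eps]. *)
pose t0 := eps * tau / 2.
have t00 : 0 < t0 by rewrite divr_gt0 ?mulr_gt0.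
have [E [mE Ebound PE]] := gaussian_hankel_tail hsigma heta t00.
exists E; split => //.
  (* The event bounds the noise matrix on all vectors at once, so it serves every [w]. *)
  move=> t Et /=; apply: ge_ereal_sup => _ [w _ <-]; rewrite lee_fin.
  apply: noise_corr_dist; first exact: ltW.
  move=> v; rewrite -(ler_pM2r tau0).
  have y0E : Hankel L y0 = Fourier_mx L omega *m right_factor (L.*2 - L) omega x.
    by rewrite hy0 Hankel_factor.
  have hE u : norm2 ((Hankel L (y t) - Fourier_mx L omega *m right_factor (L.*2 - L) omega x) ^t* *m u)
      <= t0 * norm2 u.
    rewrite -y0E hy; apply: le_trans (Ebound t Et u).
    rewrite (_ : _ - _ = Hankel L (\col_m ((eta m t)%:C)%C))//.
    by apply/matrixP => p q; rewrite !mxE addrC addKr.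
  have hW' : orthobasis_range_perp (Fourier_mx L omega *m right_factor (L.*2 - L) omega x) W.
    by rewrite -y0E.
  have kx0 : 0 < Num.sqrt kap * xmin by rewrite mulr_gt0.
  have := music_perturbation sk0 kx0 (ltW t00) hPhi (hG _ nL) hE hW' (hWhat t) v.
  rewrite -/tau => /le_trans; apply.
  by rewrite /t0 le_eqVlt; apply/orP; left; apply/eqP; field.
apply: le_trans PE; rewrite lee_fin lerD2l lerN2.
set N : R := (L.*2 + 2)%:R; set n := L.*2.+1.
have NE : N = n.+1%:R by rewrite /N addn2.
have n3 : (3 <= n)%N by rewrite /n; case: (L) L0.
rewrite NE; apply: le_trans _ (union_bound_numeric n3 hnu); rewrite -NE.
have n0 : 0 < n%:R :> R by rewrite ltr0n.
have lnN : 0 < ln N by rewrite NE ln_gt0// ltr1n.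
have nu0 : 0 < nu by exact: lt_trans hnu.
have D0 : 0 < nu * N * ln N by rewrite !mulr_gt0// NE ltr0n.
move: hsnr; rewrite -/N; move: (nu * N * ln N) D0 => D D0 hsnr.
have q0 : 0 < Num.sqrt D by rewrite sqrtr_gt0.
(* With M = 2L the noise hypothesis reads sigma sqrt D < t0 / K, so the whole of K is gained. *)
have Kq : K * (sigma * Num.sqrt D) <= t0.
  have -> : t0 = K * (xmin * L%:R * eps / (2 * Cs)).
    by rewrite /t0 tauE /kap; field; rewrite gt_eqF.
  rewrite ler_pM2l// ltW//; move: hsnr; rewrite ltr_pdivrMr// => hsnr.
  rewrite -ltr_pdivlMr//; apply: (lt_le_trans hsnr).
  rewrite le_eqVlt; apply/orP; left; apply/eqP.
  by rewrite -mul2n natrM; field; rewrite !gt_eqF.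
have t2 : 8 / 3 * (sigma ^+ 2 * D) <= t0 ^+ 2.
  apply: (@le_trans _ _ ((K * (sigma * Num.sqrt D)) ^+ 2)); last first.
    by rewrite ler_pXn2r// nnegrE ?(ltW t00)// !mulr_ge0// ltW.
  rewrite !exprMn (sqr_sqrtr (ltW D0)) ler_wpM2r//.
  by rewrite mulr_ge0 ?sqr_ge0 ?(ltW D0).
have s2 : 0 < sigma ^+ 2 by rewrite exprn_gt0.
(* 8/3 over the 2 of the Gaussian exponent gives the 4/3 of [union_bound_numeric]. *)
rewrite (ler_pM2l n0) ler_pM2l// ler_expR lerN2.
rewrite ler_pdivrMr// [leRHS]mulrAC ler_pdivlMr ?mulr_gt0//.
move: t2 s2 n0; move: (t0 ^+ 2) (sigma ^+ 2) (n%:R : R) => tt ss nn t2 s2 n0.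
have -> : 4 / 3 * D * (2 * ss * nn) = 8 / 3 * (ss * D) * nn by field.
by rewrite ler_pM2r.
Qed.
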